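(* Consider, on every element of the mesh, the semi-discrete scheme (ECDGSEM) for the two-dimensional shallow water equations with time-independent bottom topography $b$, $$\mathbf J\circ(\mathbf W_k)_t+\mathbf P_k+\mathbf R_k=\mathbf S\left(\tilde{\mathbf F}_k^{*,ec}-\tilde{\mathbf F}_k\right)+\left(\tilde{\mathbf G}_k^{*,ec}-\tilde{\mathbf G}_k\right)\mathbf S+\mathbf{source}_k,\qquad k=1,2,3,$$ with the following ingredients (notation as in the context). (Volume terms) The flux-differencing arrays $\mathbf P_k,\mathbf R_k$ have entries, for $i,j=0,\dots,N$, $$P_k^{i,j}=\frac1{\omega_i}\sum_{m=0}^N2Q_{im}\Big(F_k^{vol}(\vec W^{i,j},\vec W^{m,j})\,\tfrac{y_\eta^{i,j}+y_\eta^{m,j}}2-G_k^{vol}(\vec W^{i,j},\vec W^{m,j})\,\tfrac{x_\eta^{i,j}+x_\eta^{m,j}}2\Big),$$ $$R_k^{i,j}=\frac1{\omega_j}\sum_{m=0}^N2Q_{jm}\Big(-F_k^{vol}(\vec W^{i,j},\vec W^{i,m})\,\tfrac{y_\xi^{i,j}+y_\xi^{i,m}}2+G_k^{vol}(\vec W^{i,j},\vec W^{i,m})\,\tfrac{x_\xi^{i,j}+x_\xi^{i,m}}2\Big),$$ where, with $\{\!\{\cdot\}\!\}$ the arithmetic mean over the two argument states, $$\vec F^{vol}=\begin{pmatrix}\{\!\{hu\}\!\}\\ \{\!\{hu\}\!\}\{\!\{u\}\!\}+g\{\!\{h\}\!\}^2-\tfrac12g\{\!\{h^2\}\!\}\\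 \{\!\{hu\}\!\}\{\!\{v\}\!\}\end{pmatrix},\qquad \vec G^{vol}=\begin{pmatrix}\{\!\{hv\}\!\}\\ \{\!\{hv\}\!\}\{\!\{u\}\!\}\\ \{\!\{hv\}\!\}\{\!\{v\}\!\}+g\{\!\{h\}\!\}^2-\tfrac12g\{\!\{h^2\}\!\}\end{pmatrix}.$$ (Surface fluxes) $\tilde{\mathbf F}_k^{*,ec}$ and $\tilde{\mathbf G}_k^{*,ec}$ are the contravariant numerical fluxes built from $$\vec F^{*,ec}=\begin{pmatrix}\{\!\{h\}\!\}\{\!\{u\}\!\}\\ \{\!\{h\}\!\}\{\!\{u\}\!\}^2+\tfrac12g\{\!\{h^2\}\!\}\\ \{\!\{h\}\!\}\{\!\{u\}\!\}\{\!\{v\}\!\}\end{pmatrix},\qquad \vec G^{*,ec}=\begin{pmatrix}\{\!\{h\}\!\}\{\!\{v\}\!\}\\ \{\!\{h\}\!\}\{\!\{u\}\!\}\{\!\{v\}\!\}\\ \{\!\{h\}\!\}\{\!\{v\}\!\}^2+\tfrac12g\{\!\{h^2\}\!\}\end{pmatrix},$$ where $\{\!\{\cdot\}\!\}$ is the mean of the inner and outer states at the interface node. (Source term) $\mathbf{source}_1=\mathbf 0$, $$\mathbf{source}_2=-\tfrac g2\mathbf h\circ\big[\mathbf y_\eta\circ\mathbf D\mathbf b+\mathbf D(\mathbf y_\eta\circ\mathbf b)-\mathbf y_\xi\circ(\mathbf b\mathbf D^T)-(\mathbf y_\xi\circ\mathbf b)\mathbf D^T\big]-\tfrac g2\mathbf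 M^{-1}\big(\mathbf y_\eta\circ\{\!\{\mathbf h\}\!\}_\xi\circ[\![\mathbf b]\!]_\xi\big)+\tfrac g2\big(\mathbf y_\xi\circ\{\!\{\mathbf h\}\!\}_\eta\circ[\![\mathbf b]\!]_\eta\big)\mathbf M^{-1},$$ $$\mathbf{source}_3=-\tfrac g2\mathbf h\circ\big[-\mathbf x_\eta\circ\mathbf D\mathbf b-\mathbf D(\mathbf x_\eta\circ\mathbf b)+\mathbf x_\xi\circ(\mathbf b\mathbf D^T)+(\mathbf x_\xi\circ\mathbf b)\mathbf D^T\big]+\tfrac g2\mathbf M^{-1}\big(\mathbf x_\eta\circ\{\!\{\mathbf h\}\!\}_\xi\circ[\![\mathbf b]\!]_\xi\big)-\tfrac g2\big(\mathbf x_\xi\circ\{\!\{\mathbf h\}\!\}_\eta\circ[\![\mathbf b]\!]_\eta\big)\mathbf M^{-1}.$$ Then the scheme has the following properties: 1. It discretely conserves the mass ($k=1$), and, if the bottom topography is constant, it discretely conserves the momentum ($k=2,3$). 2. It discretely conserves the total energy, which is an entropy function for the shallow water equations: for every solution of the scheme, $\frac{d}{dt}\sum_{G}\sum_{i,j=0}^N\omega_i\omega_jJ^{i,j}\,e^{i,j}=0$, where the outer sum is over all elements. 3. It is discretely well-balanced for arbitrary (possibly discontinuous across element interfaces) bottom topographies.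
   Context: Shallow water equations: $h_t+(hu)_x+(hv)_y=0$, $(hu)_t+(hu^2+gh^2/2)_x+(huv)_y=-ghb_x$, $(hv)_t+(huv)_x+(hv^2+gh^2/2)_y=-ghb_y$, where $g>0$ is constant, $h$ is the water height, $(u,v)$ the velocity and $b=b(x,y)$ the bottom topography. Conserved variables $\vec w=(w_1,w_2,w_3)=(h,hu,hv)$; physical fluxes $\vec f=(hu,hu^2+gh^2/2,huv)^T$, $\vec g=(hv,huv,hv^2+gh^2/2)^T$. Entropy function (total energy): $e=\tfrac12h(u^2+v^2)+\tfrac12gh^2+ghb$. Operators. Fix $N\ge1$. Let $\xi_0=-1<\dots<\xi_N=1$ be the Legendre-Gauss-Lobatto (LGL) nodes on $[-1,1]$ with quadrature weights $\omega_0,\dots,\omega_N>0$, and $\ell_j$ the associated Lagrange polynomials. Set $D_{ij}=\ell_j'(\xi_i)$, $\mathbf M=\mathrm{diag}(\omega_0,\dots,\omega_N)$, $\mathbf Q=\mathbf M\mathbf D$, $\mathbf S=\mathrm{diag}(1/\omega_0,0,\dots,0,-1/\omega_N)$. The summation-by-parts property $\mathbf Q+\mathbf Q^T=\mathrm{diag}(-1,0,\dots,0,1)$ holds. Nodal arrays. On each element a quantity is represented by the $(N+1)\times(N+1)$ array of its values at the nodes $(\xi_i,\eta_j)$, $\eta_j=\xi_j$, with row index $i$ ($\xi$-direction) and column index $j$ ($\eta$-direction). So $\mathbf D\mathbf A$ and $\mathbf A\mathbf D^T$ are the discrete $\xi$- and $\eta$-derivatives; $\circ$ is the entrywise (Hadamard)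 product. $\vec W^{i,j}=(W_1^{i,j},W_2^{i,j},W_3^{i,j})$ are the time-dependent nodal values of $(h,hu,hv)$; the nodal heights are assumed positive and $u^{i,j}=W_2^{i,j}/W_1^{i,j}$, $v^{i,j}=W_3^{i,j}/W_1^{i,j}$. The arrays $\mathbf h,\mathbf b$ contain the nodal values of $h$ and $b$ ($\mathbf b$ is time-independent and may be chosen independently on each element). $e^{i,j}$ is $e$ evaluated at node $(i,j)$. Mesh and metric terms. The domain is divided into finitely many non-overlapping, possibly curved, quadrilateral elements $G$; each is the image of $[-1,1]^2$ under a map $(x(\xi,\eta),y(\xi,\eta))$ that is polynomial of degree at most $N$ in each variable (transfinite interpolation with linear blending of boundary curves that are polynomials of degree at most $N$). $\mathbf x_\xi,\mathbf x_\eta,\mathbf y_\xi,\mathbf y_\eta$ are the nodal arrays of the derivatives of this map, and $\mathbf J$ has entries $J^{i,j}=x_\xi y_\eta-x_\eta y_\xi>0$. The discrete metric identities $\mathbf D\mathbf y_\eta-\mathbf y_\xi\mathbf D^T=\mathbf 0$ and $-\mathbf D\mathbf x_\eta+\mathbf x_\xi\mathbf D^T=\mathbf 0$ hold. The mesh is conforming and boundary conditions are periodic: every element side is paired with exactly one other element side, and its $N+1$ nodes are paired with the nodes of that side (in the same or reversed order). At paired nodes the outward scaled normals, which are $\pm(y_\eta,-x_\eta)$ on sides $\xi=\pm1$ and $\pm(-y_\xi,x_\xi)$ on sides $\eta=\pm1$, are negatives of each other. At a node of a side, the ''inner'' value is that of the element itself, and the ''outer'' value is that of the paired node of the neighbouring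 element. Interface quantities. $\{\!\{\mathbf h\}\!\}_\xi$ and $[\![\mathbf b]\!]_\xi$ are arrays whose only nonzero rows are $i=0$ and $i=N$ (sides $\xi=-1$ and $\xi=1$); there $\{\!\{h\}\!\}$ is the arithmetic mean of inner and outer value, while $[\![b]\!]$ is inner minus outer on $\xi=-1$ and outer minus inner on $\xi=1$. $\{\!\{\mathbf h\}\!\}_\eta$ and $[\![\mathbf b]\!]_\eta$ are defined in the same way with nonzero columns $j=0,N$ and sides $\eta=\mp1$. Contravariant fluxes. $\tilde F_k^{i,j}=y_\eta^{i,j}f_k(\vec W^{i,j})-x_\eta^{i,j}g_k(\vec W^{i,j})$ and $\tilde G_k^{i,j}=-y_\xi^{i,j}f_k(\vec W^{i,j})+x_\xi^{i,j}g_k(\vec W^{i,j})$. Given numerical fluxes $\vec F^*,\vec G^*$ at interface nodes, $\tilde{\mathbf F}_k^*$ has entries $y_\eta F_k^*-x_\eta G_k^*$ in rows $i=0,N$ (evaluated with the states on both sides of $\xi=\mp1$) and zeros elsewhere; $\tilde{\mathbf G}_k^*$ has entries $-y_\xi F_k^*+x_\xi G_k^*$ in columns $j=0,N$ (evaluated with the states on both sides of $\eta=\mp1$) and zeros elsewhere. Discrete conservation of component $k$ means: on each element, $$\sum_{i,j=0}^N\omega_i\omega_jJ^{i,j}(W_k^{i,j})_t=-\sum_{j=0}^N\omega_j\big[(\tilde F_k^* )^{N,j}-(\tilde F_k^* )^{0,j}\big]-\sum_{i=0}^N\omega_i\big[(\tilde G_k^* )^{i,N}-(\tilde G_k^* )^{i,0}\big],$$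 where $\tilde F_k^*,\tilde G_k^*$ are the contravariant numerical fluxes used in the scheme, and consequently $\frac{d}{dt}\sum_G\sum_{i,j}\omega_i\omega_jJ^{i,j}W_k^{i,j}=0$. Discretely well-balanced means: whenever the nodal values satisfy the ''lake at rest'' condition, i.e. $h+b$ equals one and the same constant at all nodes of all elements and $u=v=0$ at all nodes, the scheme yields $(\mathbf W_k)_t=\mathbf 0$ for $k=1,2,3$ on every element. *)

(* Defs.v *)
From HB Require Import structures.
From mathcomp Require Import all_boot all_order all_algebra.
From mathcomp Require Import all_classical all_reals all_analysis.
Set Implicit Arguments.
Unset Strict Implicit.
Unset Printing Implicit Defensive.
Import Order.TTheory GRing.Theory Num.Theory.
Import numFieldNormedType.Exports.
Local Open Scope classical_set_scope.
Local Open Scope ring_scope.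

Notation "A ⊙ B" := (map2_mx *%R A B) (at level 40, left associativity)
  : ring_scope.

Section ShallowWater.
Variables (R : realType) (g : R).

Definition vec3 (a b c : R) : 'rV[R]_3 := \row_(k < 3) [:: a; b; c]`_k.

(* A state is the row vector (h, hu, hv). *)
Definition height (w : 'rV[R]_3) : R := w 0 0.
Definition sqheight (w : 'rV[R]_3) : R := height w ^+ 2.
Definition momx (w : 'rV[R]_3) : R := w 0 1.
Definition momy (w : 'rV[R]_3) : R := w 0 2.
Definition velx (w : 'rV[R]_3) : R := momx w / height w.
Definition vely (w : 'rV[R]_3) : R := momy w / height w.

Definition flux_f (w : 'rV[R]_3) : 'rV[R]_3 :=
  vec3 (momx w)
       (height w * velx w ^+ 2 + g * height w ^+ 2 / 2)
       (height w * velx w * vely w).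

Definition flux_g (w : 'rV[R]_3) : 'rV[R]_3 :=
  vec3 (momy w)
       (height w * velx w * vely w)
       (height w * vely w ^+ 2 + g * height w ^+ 2 / 2).

Definition energy (w : 'rV[R]_3) (b : R) : R :=
  height w * (velx w ^+ 2 + vely w ^+ 2) / 2 + g * height w ^+ 2 / 2
  + g * height w * b.

(* Solutions [w t x y] over the bottom [b x y] on a space-time region [D];
   only the partial derivatives that occur are required to exist. *)
Definition swe_solution (D : set (R * R * R)) (w : R -> R -> R -> 'rV[R]_3)
    (b : R -> R -> R) : Prop :=
  forall t x y, D (t, x, y) ->
  [/\ 0 < height (w t x y),
      forall k : 'I_3,
        [/\ derivable (fun s => w s x y 0 k) t 1,
            derivable (fun s => w t s y 0 k) x 1 &
            derivable (fun s => w t x s 0 k) y 1],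
      derivable (fun s => b s y) x 1,
      derivable (fun s => b x s) y 1 &
      forall k : 'I_3,
        derive1 (fun s => w s x y 0 k) t
        + derive1 (fun s => flux_f (w t s y) 0 k) x
        + derive1 (fun s => flux_g (w t x s) 0 k) y
        = vec3 0 (- g * height (w t x y) * derive1 (fun s => b s y) x)
                 (- g * height (w t x y) * derive1 (fun s => b x s) y) 0 k].

(* Strictly convex in the conserved variables for each bottom value, with
   entropy fluxes [phi] and [psi] for which every solution satisfies
   [e_t + phi_x + psi_y = 0]. *)
Definition entropy_function (e : 'rV[R]_3 -> R -> R) : Prop :=
  (forall (b : R) (w w' : 'rV[R]_3) (s : R),
     0 < height w -> 0 < height w' -> w <> w' -> 0 < s < 1 ->
     e (s *: w + (1 - s) *: w') b < s * e w b + (1 - s) * e w' b) /\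
  exists phi psi : 'rV[R]_3 -> R -> R,
    forall (D : set (R * R * R)) (w : R -> R -> R -> 'rV[R]_3)
           (b : R -> R -> R),
    open D -> swe_solution D w b ->
    forall t x y, D (t, x, y) ->
    exists et ex ey : R,
    [/\ is_derive t 1 (fun s => e (w s x y) (b x y)) et,
        is_derive x 1 (fun s => phi (w t s y) (b s y)) ex,
        is_derive y 1 (fun s => psi (w t x s) (b x s)) ey &
        et + ex + ey = 0].

Definition avg (a b : R) : R := (a + b) / 2.

Section NumericalFluxes.
Variables w1 w2 : 'rV[R]_3.

Local Notation "{{ q }}" := (avg (q w1) (q w2)) (at level 0, q at level 99).

Definition flux_f_vol : 'rV[R]_3 :=
  vec3 {{ momx }}
       ({{ momx }} * {{ velx }} + g * {{ height }} ^+ 2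
        - g * {{ sqheight }} / 2)
       ({{ momx }} * {{ vely }}).

Definition flux_g_vol : 'rV[R]_3 :=
  vec3 {{ momy }}
       ({{ momy }} * {{ velx }})
       ({{ momy }} * {{ vely }} + g * {{ height }} ^+ 2
        - g * {{ sqheight }} / 2).

Definition flux_f_ec : 'rV[R]_3 :=
  vec3 ({{ height }} * {{ velx }})
       ({{ height }} * {{ velx }} ^+ 2 + g * {{ sqheight }} / 2)
       ({{ height }} * {{ velx }} * {{ vely }}).

Definition flux_g_ec : 'rV[R]_3 :=
  vec3 ({{ height }} * {{ vely }})
       ({{ height }} * {{ velx }} * {{ vely }})
       ({{ height }} * {{ vely }} ^+ 2 + g * {{ sqheight }} / 2).

End NumericalFluxes.
End ShallowWater.

Section Operators.
Variables (R : realType) (N : nat).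

(* Rodrigues' formula *)
Definition legendre (n : nat) : {poly R} :=
  ((2 ^ n * n`!)%:R)^-1 *: derivn n (('X^2 - 1) ^+ n).

Definition lgl_nodes (xi : 'I_N.+1 -> R) : Prop :=
  [/\ xi ord0 = -1, xi ord_max = 1,
      (forall i j : 'I_N.+1, (i < j)%N -> xi i < xi j) &
      (forall i : 'I_N.+1, i != ord0 -> i != ord_max ->
         root (deriv (legendre N)) (xi i))].

Variable xi : 'I_N.+1 -> R.

Definition lagrange_poly (j : 'I_N.+1) : {poly R} :=
  \prod_(m < N.+1 | m != j) ((xi j - xi m)^-1 *: ('X - (xi m)%:P)).

Definition lgl_weight (i : 'I_N.+1) : R :=
  (\int[lebesgue_measure]_(x in `[(-1 : R), 1]) (lagrange_poly i).[x])%R.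

Definition lgl_diffmx : 'M[R]_N.+1 :=
  \matrix_(i, j) (deriv (lagrange_poly j)).[xi i].

Definition lgl_massmx : 'M[R]_N.+1 := diag_mx (\row_i lgl_weight i).

Definition lgl_sbpmx : 'M[R]_N.+1 := lgl_massmx *m lgl_diffmx.

Definition lgl_surfmx : 'M[R]_N.+1 :=
  diag_mx (\row_i (if i == ord0 then (lgl_weight ord0)^-1
                   else if i == ord_max then - (lgl_weight ord_max)^-1
                   else 0)).

(* In a bivariate polynomial the outer variable is xi and the inner one is
   eta, so that [p.[x, y]] is the value at (xi, eta) = (x, y). *)
Definition nodal (p : {poly {poly R}}) : 'M[R]_N.+1 :=
  \matrix_(i, j) p.[xi i, xi j].
Definition nodal_dxi (p : {poly {poly R}}) : 'M[R]_N.+1 :=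
  nodal (deriv p).
Definition nodal_deta (p : {poly {poly R}}) : 'M[R]_N.+1 :=
  nodal (map_poly (@deriv R) p).

(* [p] is the linear blending of its restrictions to the four sides. *)
Definition transfinite (p : {poly {poly R}}) : Prop :=
  forall r s : R,
  p.[r, s] =
    (1 - r) / 2 * p.[-1, s] + (1 + r) / 2 * p.[1, s]
    + (1 - s) / 2 * p.[r, -1] + (1 + s) / 2 * p.[r, 1]
    - ((1 - r) * (1 - s) / 4 * p.[-1, -1] + (1 + r) * (1 - s) / 4 * p.[1, -1]
       + (1 - r) * (1 + s) / 4 * p.[-1, 1] + (1 + r) * (1 + s) / 4 * p.[1, 1]).

Definition image_square (px py : {poly {poly R}}) : set (R * R) :=
  [set z | exists r s : R, [/\ -1 <= r <= 1, -1 <= s <= 1 &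
                               z = (px.[r, s], py.[r, s])]].

(* West, East: xi = -1, 1; South, North: eta = -1, 1. *)
Inductive side := West | East | South | North.

Definition side_node (s : side) (k : 'I_N.+1) : 'I_N.+1 * 'I_N.+1 :=
  match s with
  | West => (ord0, k)
  | East => (ord_max, k)
  | South => (k, ord0)
  | North => (k, ord_max)
  end.

Definition outward_normal (px py : {poly {poly R}}) (s : side)
    (k : 'I_N.+1) : R * R :=
  let: (i, j) := side_node s k in
  let n_xi := (nodal_deta py i j, - nodal_deta px i j) in
  let n_eta := (- nodal_dxi py i j, nodal_dxi px i j) in
  match s with
  | West => - n_xi
  | East => n_xi
  | South => - n_eta
  | North => n_eta
  end.

Definition jac_array (px py : {poly {poly R}}) : 'M[R]_N.+1 :=
  nodal_dxi px ⊙ nodal_deta py - nodal_deta px ⊙ nodal_dxi py.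

(* [nbr] pairs the sides; [flip] tells whether the nodes of the paired side
   are traversed in reversed order. *)
Record mesh := Mesh {
  elem : finType;
  mapx : elem -> {poly {poly R}};
  mapy : elem -> {poly {poly R}};
  nbr : elem * side -> elem * side;
  flip : elem * side -> bool;
  mesh_degree : forall K,
    [/\ (size (mapx K) <= N.+1)%N, (sizeY (mapx K) <= N.+1)%N,
        (size (mapy K) <= N.+1)%N & (sizeY (mapy K) <= N.+1)%N];
  mesh_transfinite : forall K, transfinite (mapx K) /\ transfinite (mapy K);
  mesh_jacobian : forall K i j, 0 < jac_array (mapx K) (mapy K) i j;
  mesh_nonoverlapping : forall K L, K != L ->
    (image_square (mapx K) (mapy K))° `&` (image_square (mapx L) (mapy L))°
    = set0;
  nbr_involutive : involutive nbr;
  nbr_neq : forall f, nbr f <> f;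
  flip_nbr : forall f, flip (nbr f) = flip f;
  mesh_normals : forall (f : elem * side) (k : 'I_N.+1),
    let f' := nbr f in
    outward_normal (mapx f'.1) (mapy f'.1) f'.2
                   (if flip f then rev_ord k else k)
    = - outward_normal (mapx f.1) (mapy f.1) f.2 k
}.

End Operators.

Section Scheme.
Variables (R : realType) (N : nat) (xi : 'I_N.+1 -> R) (T : mesh xi) (g : R).

Local Notation array := 'M[R]_N.+1.
Local Notation D := (lgl_diffmx xi).
Local Notation M := (lgl_massmx xi).
Local Notation Q := (lgl_sbpmx xi).
Local Notation S := (lgl_surfmx xi).
Local Notation omega := (lgl_weight xi).

Definition x_xi (K : elem T) : array := nodal_dxi xi (mapx K).
Definition x_eta (K : elem T) : array := nodal_deta xi (mapx K).
Definition y_xi (K : elem T) : array := nodal_dxi xi (mapy K).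
Definition y_eta (K : elem T) : array := nodal_deta xi (mapy K).
Definition Jac (K : elem T) : array := jac_array xi (mapx K) (mapy K).

(* Value, at the node paired with node [k] of side [s] of [K], of nodal data
   [A] on the whole mesh. *)
Definition outer (V : Type) (A : elem T -> 'I_N.+1 -> 'I_N.+1 -> V)
    (K : elem T) (s : side) (k : 'I_N.+1) : V :=
  let f := nbr (K, s) in
  let: (i, j) := side_node f.2 (if flip (K, s) then rev_ord k else k) in
  A f.1 i j.

(* Arrays supported on the rows i = 0, N, resp. the columns j = 0, N. *)
Definition xi_sides (a : side -> 'I_N.+1 -> R) : array :=
  \matrix_(i, j) (if i == ord0 then a West j
                  else if i == ord_max then a East j else 0).
Definition eta_sides (a : side -> 'I_N.+1 -> R) : array :=
  \matrix_(i, j) (if j == ord0 then a South i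
                  else if j == ord_max then a North i else 0).

Definition at_side (A : array) (s : side) (k : 'I_N.+1) : R :=
  let: (i, j) := side_node s k in A i j.

Definition side_avg (A : elem T -> array) (K : elem T) (s : side)
    (k : 'I_N.+1) : R :=
  avg (at_side (A K) s k) (outer (fun L => A L) K s k).

(* Always (value on the positive side) - (value on the negative side) with
   respect to the local coordinate. *)
Definition side_jump (A : elem T -> array) (K : elem T) (s : side)
    (k : 'I_N.+1) : R :=
  let inner_val := at_side (A K) s k in
  let outer_val := outer (fun L => A L) K s k in
  match s with
  | West | South => inner_val - outer_val
  | East | North => outer_val - inner_val
  end.

(* Nodal values of (h, hu, hv) on all elements. *)
Definition nodal_field := elem T -> 'I_3 -> array.

Definition state (W : nodal_field) (K : elem T) (i j : 'I_N.+1) : 'rV[R]_3 :=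
  \row_k W K k i j.

Definition positive_heights (W : nodal_field) : Prop :=
  forall K i j, 0 < height (state W K i j).

Section RightHandSide.
Variables (b : elem T -> array) (W : nodal_field) (K : elem T) (k : 'I_3).

Local Notation w := (state W K).

Definition Ftilde : array :=
  \matrix_(i, j) (y_eta K i j * flux_f g (w i j) 0 k
                  - x_eta K i j * flux_g g (w i j) 0 k).

Definition Gtilde : array :=
  \matrix_(i, j) (- y_xi K i j * flux_f g (w i j) 0 k
                  + x_xi K i j * flux_g g (w i j) 0 k).

Definition Fstar (s : side) (m : 'I_N.+1) : R :=
  let: (i, j) := side_node s m in
  flux_f_ec g (w i j) (outer (state W) K s m) 0 k.

Definition Gstar (s : side) (m : 'I_N.+1) : R :=
  let: (i, j) := side_node s m in
  flux_g_ec g (w i j) (outer (state W) K s m) 0 k.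

Definition Ftilde_ec : array :=
  xi_sides (fun s m => at_side (y_eta K) s m * Fstar s m
                       - at_side (x_eta K) s m * Gstar s m).

Definition Gtilde_ec : array :=
  eta_sides (fun s m => - at_side (y_xi K) s m * Fstar s m
                        + at_side (x_xi K) s m * Gstar s m).

Definition volume_P : array :=
  \matrix_(i, j) ((omega i)^-1 * \sum_(m < N.+1) 2 * Q i m *
    (flux_f_vol g (w i j) (w m j) 0 k * avg (y_eta K i j) (y_eta K m j)
     - flux_g_vol g (w i j) (w m j) 0 k * avg (x_eta K i j) (x_eta K m j))).

Definition volume_R : array :=
  \matrix_(i, j) ((omega j)^-1 * \sum_(m < N.+1) 2 * Q j m *
    (- flux_f_vol g (w i j) (w i m) 0 k * avg (y_xi K i j) (y_xi K i m)
     + flux_g_vol g (w i j) (w i m) 0 k * avg (x_xi K i j) (x_xi K i m))).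

Local Notation h := (W K 0).
Local Notation avgh_xi := (xi_sides (side_avg (fun L => W L 0) K)).
Local Notation avgh_eta := (eta_sides (side_avg (fun L => W L 0) K)).
Local Notation jumpb_xi := (xi_sides (side_jump b K)).
Local Notation jumpb_eta := (eta_sides (side_jump b K)).

Definition source2 : array :=
  - (g / 2) *: (h ⊙ (y_eta K ⊙ (D *m b K) + D *m (y_eta K ⊙ b K)
                     - y_xi K ⊙ (b K *m D^T) - (y_xi K ⊙ b K) *m D^T))
  - (g / 2) *: (invmx M *m (y_eta K ⊙ avgh_xi ⊙ jumpb_xi))
  + (g / 2) *: ((y_xi K ⊙ avgh_eta ⊙ jumpb_eta) *m invmx M).

Definition source3 : array :=
  - (g / 2) *: (h ⊙ (- (x_eta K ⊙ (D *m b K)) - D *m (x_eta K ⊙ b K)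
                     + x_xi K ⊙ (b K *m D^T) + (x_xi K ⊙ b K) *m D^T))
  + (g / 2) *: (invmx M *m (x_eta K ⊙ avgh_xi ⊙ jumpb_xi))
  - (g / 2) *: ((x_xi K ⊙ avgh_eta ⊙ jumpb_eta) *m invmx M).

Definition source : array := [:: 0; source2; source3]`_k.

End RightHandSide.

(* The scheme, as a relation between the nodal values [W] and their time
   derivatives [Wt]. *)
Definition ecdgsem (b : elem T -> array) (W Wt : nodal_field) : Prop :=
  forall K k,
  Jac K ⊙ Wt K k + volume_P W K k + volume_R W K k
  = S *m (Ftilde_ec W K k - Ftilde W K k)
    + (Gtilde_ec W K k - Gtilde W K k) *m S
    + source b W K k.

Definition time_derivative (W : R -> nodal_field) (t : R) : nodal_field :=
  fun K k => \matrix_(i, j) derive1 (fun s => W s K k i j) t.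

Definition ecdgsem_solution (b : elem T -> array) (I : set R)
    (W : R -> nodal_field) : Prop :=
  forall t, I t ->
  [/\ positive_heights (W t),
      (forall K k i j, derivable (fun s => W s K k i j) t 1) &
      ecdgsem b (W t) (time_derivative W t)].

Definition mesh_integral (a : elem T -> array) : R :=
  \sum_(K : elem T) \sum_(i < N.+1) \sum_(j < N.+1)
    omega i * omega j * Jac K i j * a K i j.

Definition discretely_conserves (b : elem T -> array) (k : 'I_3) : Prop :=
  (forall W Wt : nodal_field, positive_heights W -> ecdgsem b W Wt ->
   forall K,
   \sum_(i < N.+1) \sum_(j < N.+1)
      omega i * omega j * Jac K i j * Wt K k i j
   = - (\sum_(j < N.+1) omega j *
          (Ftilde_ec W K k ord_max j - Ftilde_ec W K k ord0 j))
     - (\sum_(i < N.+1) omega i *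
          (Gtilde_ec W K k i ord_max - Gtilde_ec W K k i ord0))) /\
  (forall (I : set R) (W : R -> nodal_field), open I -> ecdgsem_solution b I W ->
   forall t, I t ->
   is_derive t 1 (fun s => mesh_integral (fun K => W s K k)) 0).

Definition conserves_total_energy (b : elem T -> array) : Prop :=
  forall (I : set R) (W : R -> nodal_field), open I -> ecdgsem_solution b I W ->
  forall t, I t ->
  is_derive t 1
    (fun s => mesh_integral
       (fun K => \matrix_(i, j) energy g (state (W s) K i j) (b K i j))) 0.

Definition lake_at_rest (b : elem T -> array) (W : nodal_field) : Prop :=
  exists c : R, forall K i j,
  [/\ height (state W K i j) + b K i j = c,
      velx (state W K i j) = 0 & vely (state W K i j) = 0].

Definition discretely_well_balanced (b : elem T -> array) : Prop :=
  forall W Wt : nodal_field, positive_heights W -> lake_at_rest b W ->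
  ecdgsem b W Wt -> forall K k, Wt K k = 0.

End Scheme.

(* Main.v *)
From HB Require Import structures.
Require Import Defs.
From mathcomp Require Import all_boot all_order all_algebra.
From mathcomp Require Import all_classical all_reals all_analysis.
From mathcomp Require Import ring lra zify.
Set Implicit Arguments.
Unset Strict Implicit.
Unset Printing Implicit Defensive.
Import Order.TTheory GRing.Theory Num.Theory.
Import numFieldNormedType.Exports.
Local Open Scope ring_scope.

(* Lobatto quadrature with N + 1 nodes is exact up to degree 2N - 1, because the
   polynomial (X^2 - 1) P_N' vanishing at the nodes is orthogonal to all
   polynomials of degree at most N - 2;
   hence Q + Q^T = diag(-1, 0, ..., 0, 1), and differentiation of the geometry
   being exact gives the discrete metric identities.

   Multiply the scheme by the quadrature weights and by a test array.  Along each
   grid line the volume terms form a sum over Q i m * V i m.  If V i m - V m i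
   telescopes as t i - t m, then summation by parts reduces the sum to the two ends
   of the line.  For the test array 1 the two-point fluxes are symmetric (t = 0); for
   the entropy variables the jump condition of the fluxes makes t an entropy
   potential, up to derivatives of the metric terms, which cancel between the two
   coordinate directions.  The bottom source is included in V, and it is what is
   needed for the bottom terms to telescope too.

   All that remains of an element are face terms that change sign from one side of a
   face to the other: the surface fluxes are symmetric in the two states, the normals
   are opposite, and the quadrature weights are symmetric under reversal of the
   nodes.  Summed over a periodic mesh they cancel.  For the lake at rest the scheme
   is evaluated pointwise, and h + b = const reduces everything to the metric
   identities. *)

(** * Lobatto quadrature *)

Section PolynomialIntegral.
Variable R : realType.
Implicit Types p q : {poly R}.

(** The coefficient of index 0 is a quotient by 0, which is 0 by the convention on inverses, so this
    is the antiderivative vanishing at 0. *)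
Definition antideriv p : {poly R} := \poly_(i < (size p).+1) (p`_i.-1 / i%:R).

Lemma antiderivK p : (antideriv p)^`() = p.
Proof.
apply/polyP => i; rewrite coef_deriv coef_poly ltnS.
case: ltnP => [_|lei]; last by rewrite mul0rn nth_default.
by rewrite -[LHS]mulr_natr divfK // pnatr_eq0.
Qed.

Lemma deriv_eq0_horner p x y : p^`() = 0 -> p.[x] = p.[y].
Proof.
move=> dp0; suff -> : p = (p`_0)%:P by rewrite !hornerC.
apply/polyP => -[|i]; rewrite coefC //=.
have := coef_deriv p i; rewrite dp0 coef0 => /esym/eqP.
by rewrite mulrn_eq0 => /eqP.
Qed.

(* The integral over [-1, 1]; through the formal antiderivative it is linear
   without any integrability argument. *)
Definition pint p : R := (antideriv p).[1] - (antideriv p).[-1].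

Lemma pint_deriv p : pint p^`() = p.[1] - p.[-1].
Proof.
have /(deriv_eq0_horner 1 (-1)) : (antideriv p^`() - p)^`() = 0.
  by rewrite derivB antiderivK subrr.
by rewrite /pint !hornerE => h; lra.
Qed.

Lemma pint_is_linear : linear_for *%R pint.
Proof.
move=> a p q; rewrite -{1}(antiderivK p) -{1}(antiderivK q).
by rewrite -derivZ -derivD pint_deriv /pint !hornerD !hornerZ; ring.
Qed.
HB.instance Definition _ := GRing.isLinear.Build R {poly R} R *%R pint pint_is_linear.

Lemma pint_comp_opp p : pint (p \Po - 'X) = pint p.
Proof.
have -> : p \Po - 'X = (- (antideriv p \Po - 'X))^`().
  by rewrite derivN deriv_comp antiderivK derivN derivX mulrN1 opprK.
by rewrite pint_deriv /pint !hornerN !horner_comp !hornerN !hornerX !opprK addrC.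
Qed.

(** The antiderivative is nondecreasing on [-1, 1]. If its end values agreed it would be constant
    there, hence constant as a polynomial, and [p] would be 0. *)
Lemma pint_gt0 p : p != 0 -> (forall x, -1 <= x <= 1 -> 0 <= p.[x]) -> 0 < pint p.
Proof.
move=> p0 pge0; pose A := antideriv p.
have Amono x y : -1 <= x -> x <= y -> y <= 1 -> A.[x] <= A.[y].
  apply: (@ger0_derive1_ndecr R (horner A) (-1) 1).
  - by move=> z _; exact: derivable_horner.
  - move=> z; rewrite in_itv /= => /andP[z1 z2].
    by rewrite -derivE antiderivK pge0 // !ltW.
  - by apply: continuous_subspaceT; exact: continuous_horner.
rewrite /pint -/A subr_gt0 lt_neqAle; apply/andP; split; last by apply: Amono; lra.
apply/negP => /eqP A11.
have Acst x : -1 <= x <= 1 -> A.[x] = A.[-1].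
  move=> /andP[x1 x2]; by apply/eqP; rewrite eq_le {1}A11 !Amono.
suff A0 : A - (A.[-1])%:P = 0.
  by move: p0; rewrite -(antiderivK p) -/A -[A](subrK (A.[-1])%:P) A0 add0r derivC eqxx.
(* The distinct points 1/(i+1) of the interval supply as many roots as the size of the
   polynomial. *)
pose s := [seq (i.+1%:R^-1 : R) | i <- iota 0 (size (A - (A.[-1])%:P))].
apply: (@roots_geq_poly_eq0 _ _ s); last by rewrite size_map size_iota.
- apply/allP => _ /mapP[i _ ->]; rewrite rootE !hornerE Acst ?subrr //.
  have i1 : (i.+1%:R^-1 : R) <= 1 by rewrite invf_le1 ?ler1n ?ltr0n.
  have i0 : 0 <= (i.+1%:R^-1 : R) by rewrite invr_ge0 ler0n.
  by rewrite i1 andbT (le_trans _ i0) ?lerN10.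
- rewrite map_inj_uniq ?iota_uniq // => i j /invr_inj/eqP.
  by rewrite eqr_nat eqSS => /eqP.
Qed.

Lemma Rintegral_horner p :
  (\int[lebesgue_measure]_(x in `[(-1 : R), 1]) p.[x])%R = pint p.
Proof.
rewrite /Rintegral (@continuous_FTC2 R (horner p) (horner (antideriv p))) //.
- by apply: continuous_subspaceT; exact: continuous_horner.
- split.
  + by move=> x _; exact: derivable_horner.
  + by apply: cvg_at_right_filter; exact: continuous_horner.
  + by apply: cvg_at_left_filter; exact: continuous_horner.
- by move=> x _; rewrite -derivE antiderivK.
Qed.

End PolynomialIntegral.

(** * Legendre polynomials: orthogonality, size and parity *)

Section Legendre.
Variable R : realType.
Implicit Types p q : {poly R}.

Let U n : {poly R} := ('X^2 - 1) ^+ n.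

(** Each differentiation lowers the multiplicity of the factor $X^2-1$ by at most one. *)
Lemma derivn_X2B1_factor n m : (m <= n)%N ->
  exists r : {poly R}, derivn m (U n) = ('X^2 - 1) ^+ (n - m) * r.
Proof.
elim: m => [|m IH] ltmn; first by exists 1; rewrite subn0 mulr1.
have [r Er] := IH (ltnW ltmn).
exists (('X^2 - 1) * r^`() + r * (('X *+ 2) *+ (n - m))).
rewrite derivnS Er derivM deriv_exp derivB derivXn derivC subr0 expr1.
have -> : (n - m = (n - m.+1).+1)%N by rewrite -subSn.
rewrite /= (exprS _ (n - m.+1)) -mulrnAl.
move: ('X^2 - 1) (('X *+ 2) *+ _) r^`() => c d r'.
by move: (c ^+ _) => a; ring.
Qed.

Lemma derivn_X2B1_endpoints n m (x : R) : (m < n)%N -> x ^+ 2 = 1 ->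
  (derivn m (U n)).[x] = 0.
Proof.
move=> ltmn x2; have [r ->] := derivn_X2B1_factor (ltnW ltmn).
rewrite !hornerE x2 subrr expr0n subn_eq0 leqNgt ltmn /=.
by rewrite mul0r.
Qed.

(** Repeated integration by parts: the derivatives of order below [n] vanish at both endpoints, and
    every step lowers the size of [q] until it is 0. *)
Lemma pint_mul_derivn n m q : (m <= n)%N -> (size q <= m)%N ->
  pint (q * derivn m (U n)) = 0.
Proof.
elim: m q => [|m IH] q lemn.
  by rewrite leqn0 size_poly_eq0 => /eqP->; rewrite mul0r linear0.
move=> szq; rewrite derivnS.
have -> : q * (derivn m (U n))^`() =
    (q * derivn m (U n))^`() - q^`() * derivn m (U n).
  by rewrite derivM; ring.
rewrite linearB /= pint_deriv !hornerM !derivn_X2B1_endpoints ?expr1n ?sqrrN ?expr1n //.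
rewrite IH ?(ltnW lemn) // ?mulr0 ?subrr //.
have [->|q0] := eqVneq q 0; first by rewrite deriv0 size_poly0.
by rewrite -ltnS (leq_trans (lt_size_deriv q0)).
Qed.

Lemma pint_mul_legendre n q : (size q <= n)%N -> pint (q * legendre R n) = 0.
Proof.
by move=> szq; rewrite /legendre -scalerAr linearZ /= pint_mul_derivn ?mulr0.
Qed.

Lemma size_X2B1_exp n : size (U n) = n.*2.+1.
Proof.
have sz2 : size ('X^2 - 1 : {poly R}) = 3.
  by rewrite size_polyDl ?size_polyXn // size_polyN size_poly1.
have := size_exp ('X^2 - 1 : {poly R}) n; rewrite sz2 /=.
rewrite mul2n => <-; rewrite prednK // size_poly_gt0 expf_neq0 //.
by rewrite -size_poly_gt0 sz2.
Qed.

Lemma lead_coef_legendre_neq0 n : (legendre R n)`_n != 0.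
Proof.
rewrite coefZ mulf_neq0 ?invr_eq0 ?pnatr_eq0 -?lt0n ?muln_gt0 ?expn_gt0 ?fact_gt0 //.
rewrite coef_derivn mulrn_eq0 negb_or -lt0n ffact_gt0 leq_addr /=.
have := size_X2B1_exp n; rewrite -addnn => sz.
have : lead_coef (U n) != 0 by rewrite lead_coef_eq0 -size_poly_gt0 sz.
by rewrite /lead_coef sz.
Qed.

Lemma size_legendre n : size (legendre R n) = n.+1.
Proof.
apply/eqP; rewrite eqn_leq; apply/andP; split.
  apply/leq_sizeP => j ltnj; rewrite coefZ coef_derivn nth_default ?mul0rn ?mulr0 //.
  by rewrite size_X2B1_exp -addnn ltn_add2l.
by rewrite ltnNge; apply: contra (lead_coef_legendre_neq0 n) => /leq_sizeP->.
Qed.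

Lemma size_deriv_legendre n : size (legendre R n)^`() = n.
Proof.
case: n => [|n]; first by rewrite (size1_polyC (eq_leq (size_legendre 0))) derivC size_poly0.
apply/eqP; rewrite eqn_leq; apply/andP; split.
  rewrite -ltnS -[X in (_ < X)%N](size_legendre n.+1) lt_size_deriv //.
  by rewrite -size_poly_gt0 size_legendre.
rewrite ltnNge; apply: contra (lead_coef_legendre_neq0 n.+1) => /leq_sizeP/(_ n (leqnn _)).
by rewrite coef_deriv => /eqP; rewrite mulrn_eq0.
Qed.

(** Parity up to a scalar, which is enough to make the roots of the derivative symmetric about 0. *)
Lemma legendre_comp_opp n : exists s : R, legendre R n \Po - 'X = s *: legendre R n.
Proof.
suff [s Es] : exists s : R, derivn n (U n) \Po - 'X = s *: derivn n (U n).
  by exists s; rewrite /legendre comp_polyZ Es !scalerA mulrC.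
have: forall m, exists s : R, derivn m (U n) \Po - 'X = s *: derivn m (U n).
  elim=> [|m [s Es]].
    exists 1; rewrite scale1r derivn0 /U rmorphXn /= rmorphB /= rmorphXn /=.
    by rewrite comp_polyX rmorph1 sqrrN.
  exists (- s); rewrite derivnS scaleNr -derivZ -Es deriv_comp derivN derivX.
  by rewrite mulrN1 opprK.
by move=> /(_ n).
Qed.

Lemma root_deriv_legendreN n x : root (legendre R n)^`() x -> root (legendre R n)^`() (- x).
Proof.
have [s] := legendre_comp_opp n.
move: (legendre R n) => L /(congr1 (@deriv R)).
rewrite deriv_comp derivN derivX mulrN1 derivZ => /(congr1 (horner^~ x)) /=.
rewrite hornerZ hornerN horner_comp hornerN hornerX => h rx.
by move: h; rewrite (rootP rx) mulr0 rootE => /eqP; rewrite oppr_eq0.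
Qed.

(** A multiple of the nodal polynomial of the Lobatto points. *)
Definition lobatto_poly n : {poly R} := ('X^2 - 1) * (legendre R n)^`().

Lemma size_lobatto_poly n : (0 < n)%N -> size (lobatto_poly n) = n.+2.
Proof.
move=> n0; have := size_X2B1_exp 1; rewrite /U expr1 => sz2.
rewrite size_mul -?size_poly_gt0 ?sz2 ?size_deriv_legendre //.
Qed.

(** One integration by parts moves the derivative off $P_n$. The boundary terms contain $X^2-1$ and
    vanish, and the other factor then has degree below $n$, so it is orthogonal to $P_n$. *)
Lemma pint_mul_lobatto n q : (0 < n)%N -> (size q <= n.-1)%N ->
  pint (q * lobatto_poly n) = 0.
Proof.
move=> n0 szq; rewrite /lobatto_poly.
have -> : q * (('X^2 - 1) * (legendre R n)^`()) =
    (q * ('X^2 - 1) * legendre R n)^`() - (q * ('X^2 - 1))^`() * legendre R n.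
  by rewrite [in RHS]derivM; ring.
have ends x : x ^+ 2 = 1 -> (q * ('X^2 - 1) * legendre R n).[x] = 0.
  by move=> x2; rewrite 2!hornerM !hornerD hornerXn hornerN hornerC x2 subrr mulr0 mul0r.
rewrite linearB /= pint_deriv !ends ?sqrrN ?expr1n // subrr sub0r.
apply/eqP; rewrite oppr_eq0; apply/eqP; apply: pint_mul_legendre.
have [->|q0] := eqVneq (q * ('X^2 - 1)) 0; first by rewrite deriv0 size_poly0.
have lt1 := lt_size_deriv q0; rewrite -ltnS (leq_trans lt1) //.
have := size_X2B1_exp 1; rewrite /U expr1 => sz2.
by rewrite (leq_trans (size_polyMleq _ _)) // sz2 addn3 /= -(prednK n0) !ltnS.
Qed.

End Legendre.

(** * Lobatto nodes, weights and summation by parts *)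

Section Lobatto.
Variables (R : realType) (N : nat) (xi : 'I_N.+1 -> R).
Hypotheses (N_gt0 : (0 < N)%N) (xi_lgl : lgl_nodes xi).
Implicit Types (p q : {poly R}) (i j m : 'I_N.+1).

Local Notation l := (lagrange_poly xi).
Local Notation omega := (lgl_weight xi).
Local Notation D := (lgl_diffmx xi).
Local Notation nodes := [seq xi i | i <- enum 'I_N.+1].

Lemma ord0_neq_max : (ord0 : 'I_N.+1) != ord_max.
Proof. by rewrite -val_eqE /= neq_ltn N_gt0. Qed.

Lemma node_lt i j : (i < j)%N -> xi i < xi j.
Proof. by case: xi_lgl => _ _ + _; apply. Qed.

Lemma node_inj : injective xi.
Proof.
move=> i j eq_xi; apply: val_inj; case: (ltngtP i j) => // /node_lt;
  by rewrite eq_xi ltxx.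
Qed.

Lemma node_first : xi ord0 = -1. Proof. by case: xi_lgl. Qed.
Lemma node_last : xi ord_max = 1. Proof. by case: xi_lgl. Qed.

Lemma uniq_nodes : uniq nodes.
Proof. by rewrite map_inj_uniq ?enum_uniq //; exact: node_inj. Qed.

Lemma eq_on_nodes p q : (size p <= N.+1)%N -> (size q <= N.+1)%N ->
  (forall i, p.[xi i] = q.[xi i]) -> p = q.
Proof.
move=> szp szq pq; apply/eqP; rewrite -subr_eq0; apply/eqP.
apply: (@roots_geq_poly_eq0 _ _ nodes) uniq_nodes _.
  by apply/allP => _ /mapP[i _ ->]; rewrite rootE hornerD hornerN pq subrr.
by rewrite size_map size_enum_ord (leq_trans (size_polyD _ _)) // size_polyN geq_max szp.
Qed.

Lemma horner_lagrange i j : (l j).[xi i] = (i == j)%:R.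
Proof.
rewrite /lagrange_poly horner_prod; have [->|neq_ij] := eqVneq i j.
  rewrite big1 // => m neq_mj.
  rewrite hornerZ hornerXsubC mulVf // subr_eq0.
  by apply: contra neq_mj => /eqP/node_inj->.
by rewrite (bigD1 i) //= hornerZ hornerXsubC subrr mulr0 mul0r.
Qed.

Lemma size_lagrange j : (size (l j) <= N.+1)%N.
Proof.
apply: leq_trans (size_prod_leq _ _) _.
have -> : (\sum_(m < N.+1 | m != j) size ((xi j - xi m)^-1 *: ('X - (xi m)%:P))
    = \sum_(m < N.+1 | m != j) 2)%N.
  apply: eq_bigr => m neq_mj; rewrite size_scale ?size_XsubC //.
  rewrite invr_eq0 subr_eq0; apply: contra neq_mj => /eqP/node_inj-> //.
rewrite sum_nat_const cardC1 card_ord /=; lia.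
Qed.

Lemma lagrange_interpolation p : (size p <= N.+1)%N ->
  p = \sum_j p.[xi j] *: l j.
Proof.
move=> szp; apply: eq_on_nodes => //.
  apply: (big_ind (fun q => (size q <= N.+1)%N)); first by rewrite size_poly0.
    by move=> q r szq szr; rewrite (leq_trans (size_polyD _ _)) // geq_max szq.
  by move=> j _; apply: leq_trans (size_scale_leq _ _) (size_lagrange j).
move=> i; rewrite horner_sum (bigD1 i) //= big1 ?addr0.
  by rewrite hornerZ horner_lagrange eqxx mulr1.
by move=> j neq_ji; rewrite hornerZ horner_lagrange eq_sym (negPf neq_ji) mulr0.
Qed.

Lemma lgl_diffmx_exact p i : (size p <= N.+1)%N ->
  \sum_j D i j * p.[xi j] = p^`().[xi i].
Proof.
move=> szp; rewrite [in RHS](lagrange_interpolation szp) raddf_sum horner_sum.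
by apply: eq_bigr => j _; rewrite /= derivZ hornerZ mxE mulrC.
Qed.

Lemma lgl_weightE i : omega i = pint (l i).
Proof. exact: Rintegral_horner. Qed.

Lemma root_lobatto_node i : root (lobatto_poly R N) (xi i).
Proof.
rewrite /lobatto_poly rootM; apply/orP.
have [->|neq0] := eqVneq i ord0.
  by left; rewrite rootE hornerD hornerXn hornerN hornerC node_first sqrrN expr1n subrr.
have [->|neqN] := eqVneq i ord_max.
  by left; rewrite rootE hornerD hornerXn hornerN hornerC node_last expr1n subrr.
by right; case: xi_lgl => _ _ _; apply.
Qed.

Lemma lobatto_neq0 : lobatto_poly R N != 0.
Proof. by rewrite -size_poly_gt0 size_lobatto_poly. Qed.

(** The N + 1 nodes are already as many roots as the degree allows. *)
Lemma root_lobattoP x : reflect (exists i, x = xi i) (root (lobatto_poly R N) x).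
Proof.
apply: (iffP idP) => [rx|[i ->]]; last exact: root_lobatto_node.
apply: contrapT => xNnode.
suff : (size (x :: nodes) < N.+2)%N by rewrite /= size_map size_enum_ord ltnn.
rewrite -(size_lobatto_poly R N_gt0); apply: max_poly_roots lobatto_neq0 _ _.
  rewrite /= rx; apply/allP => _ /mapP[i _ ->]; exact: root_lobatto_node.
rewrite /= uniq_nodes andbT; by apply/mapP => -[i _ Ex]; apply: xNnode; exists i.
Qed.

(** The root set of [lobatto_poly] is symmetric, so [xi i] and [- xi (rev_ord i)] are both
    increasing enumerations of the same set, and such an enumeration is unique. *)
Lemma node_rev i : xi (rev_ord i) = - xi i.
Proof.
have sorted_of (f : 'I_N.+1 -> R) : (forall i j, (i < j)%N -> f i < f j) ->
    sorted <%R [seq f i | i <- enum 'I_N.+1].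
  move=> fmono; rewrite sorted_map.
  apply: (@sub_sorted _ (relpre val ltn)) => [x y /fmono //|].
  by rewrite -sorted_map val_enum_ord iota_ltn_sorted.
have rev_mono i' j' : (i' < j')%N -> - xi (rev_ord i') < - xi (rev_ord j').
  by move=> ltij; rewrite ltrN2 node_lt //= ltn_sub2l // (leq_ltn_trans ltij).
have := lt_sorted_eq (sorted_of _ node_lt) (sorted_of _ rev_mono).
have rootN x : root (lobatto_poly R N) x -> root (lobatto_poly R N) (- x).
  rewrite /lobatto_poly !rootM => /orP[rx|/root_deriv_legendreN->]; last by rewrite orbT.
  move: rx; rewrite !rootE !hornerD !hornerXn !hornerN !hornerC sqrrN => ->.
  by [].
have mem_iff x : x \in nodes = (x \in [seq - xi (rev_ord i) | i <- enum 'I_N.+1]).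
  apply/mapP/mapP => -[j _ ->].
    have /rootN/root_lobattoP[m Em] := root_lobatto_node j.
    by exists (rev_ord m); rewrite ?mem_enum // rev_ordK -Em opprK.
  have /rootN/root_lobattoP[m Em] := root_lobatto_node (rev_ord j).
  by exists m; rewrite ?mem_enum.
move=> /(_ mem_iff)/eq_in_map/(_ i) ->; last by rewrite mem_enum.
by rewrite opprK.
Qed.

(** The reflection of the Lagrange polynomial at [i] is the one at [rev_ord i], by comparison at the
    nodes. Faces glued in reversed order need this symmetry. *)
Lemma lgl_weight_rev i : omega (rev_ord i) = omega i.
Proof.
rewrite !lgl_weightE -(pint_comp_opp (l i)); congr pint.
have szX : (size (- 'X : {poly R}) = 2) by rewrite size_polyN size_polyX.
apply: eq_on_nodes; rewrite ?size_comp_poly2 ?size_lagrange // => j.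
rewrite horner_comp hornerN hornerX -node_rev !horner_lagrange.
by rewrite (can2_eq rev_ordK rev_ordK).
Qed.

(** Divide by the Lobatto polynomial. The multiple of it vanishes at all nodes and, its quotient
    having size at most N - 1, has integral 0; the remainder is reproduced by interpolation. *)
Lemma lgl_quadrature_exact p : (size p <= N.*2)%N ->
  \sum_i omega i * p.[xi i] = pint p.
Proof.
move=> szp.
pose q := p %/ lobatto_poly R N; pose r := p %% lobatto_poly R N.
have Ep : p = q * lobatto_poly R N + r by exact: divp_eq.
have szq : (size q <= N.-1)%N.
  rewrite size_divp ?lobatto_neq0 // size_lobatto_poly //= leq_subLR.
  by rewrite (leq_trans szp) // -addnn; lia.
have szr : (size r <= N.+1)%N.
  by rewrite -ltnS -(size_lobatto_poly R N_gt0) ltn_modp lobatto_neq0.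
have pr i : p.[xi i] = r.[xi i].
  by rewrite Ep hornerD hornerM (rootP (root_lobatto_node i)) mulr0 add0r.
rewrite [in RHS]Ep linearD /= pint_mul_lobatto // add0r.
rewrite [in RHS](lagrange_interpolation szr) linear_sum /=.
by apply: eq_bigr => i _; rewrite linearZ /= lgl_weightE pr mulrC.
Qed.

Lemma node_bounds i : -1 <= xi i <= 1.
Proof.
rewrite -node_first -node_last; apply/andP; split.
  by case: (posnP i) => [/(@ord_inj _ i ord0)->//|/(@node_lt ord0)/ltW].
have := ltn_ord i; rewrite ltnS leq_eqVlt => /orP[/eqP iN|/(@node_lt i ord_max)/ltW//].
by rewrite (_ : i = ord_max) //; apply: val_inj.
Qed.

(* The quadrature rule is not exact for the square of the Lagrange polynomial,
   but it is once one linear factor vanishing at an endpoint is removed from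
   one of the two copies; that factor has constant sign on the interval. *)
Lemma lgl_weight_gt0 i : 0 < omega i.
Proof.
pose e : 'I_N.+1 := if i == ord0 then ord_max else ord0.
have neq_ei : e != i.
  rewrite /e; case: (eqVneq i ord0) => [->|]; last by rewrite eq_sym.
  by rewrite eq_sym ord0_neq_max.
have neq_xi : xi i - xi e != 0.
  by rewrite subr_eq0; apply: contra neq_ei => /eqP/node_inj->.
pose r : {poly R} := \prod_(m < N.+1 | (m != i) && (m != e))
  ((xi i - xi m)^-1 *: ('X - (xi m)%:P)).
have El : l i = ((xi i - xi e)^-1 *: ('X - (xi e)%:P)) * r.
  by rewrite /lagrange_poly (bigD1 e) //=.
have sgn x : -1 <= x <= 1 -> 0 <= (xi i - xi e)^-1 * (x - xi e).
  move=> /andP[x1 x2]; have /andP[i1 i2] := node_bounds i.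
  move: neq_xi; rewrite /e; case: (eqVneq i ord0) => [->|_].
    rewrite node_first node_last => _.
    by rewrite -mulrNN -invrN mulr_ge0 ?invr_ge0 //; lra.
  rewrite node_first => _.
  by rewrite mulr_ge0 ?invr_ge0 //; lra.
have l0 : l i != 0.
  apply/eqP => li0; have := horner_lagrange i i; rewrite li0 horner0 eqxx.
  by move/esym/eqP; rewrite oner_eq0.
have r0 : r != 0 by apply: contra l0 => /eqP r0; rewrite El r0 mulr0.
have szr : (size r <= N)%N.
  have lin0 : (xi i - xi e)^-1 *: ('X - (xi e)%:P) != 0.
    by apply: contra l0 => /eqP lin0; rewrite El lin0 mul0r.
  have := size_lagrange i; rewrite El size_mul //.
  by rewrite size_scale ?invr_eq0 // size_XsubC.
have : 0 < pint (l i * r).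
  apply: pint_gt0 => [|x x1]; first by rewrite mulf_neq0.
  rewrite El 2!hornerM hornerZ hornerXsubC -mulrA mulr_ge0 ?sgn //.
  by rewrite -expr2 sqr_ge0.
rewrite -lgl_quadrature_exact; last first.
  rewrite (leq_trans (size_polyMleq _ _)) //.
  by have := size_lagrange i; move: szr; rewrite -addnn; lia.
rewrite (bigD1 i) //= big1 ?addr0 => [|j neq_ji]; last first.
  by rewrite hornerM horner_lagrange (negPf neq_ji) mul0r mulr0.
suff -> : (l i * r).[xi i] = r.[xi i] ^+ 2.
  by move=> h; rewrite -(pmulr_lgt0 _ (_ : 0 < r.[xi i] ^+ 2)) //;
    rewrite lt_neqAle sqr_ge0 andbT eq_sym; apply: contraTneq h => ->; rewrite mulr0 ltxx.
by rewrite El 2!hornerM hornerZ hornerXsubC mulVf // mul1r.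
Qed.

Lemma lgl_weight_neq0 i : omega i != 0.
Proof. exact/lt0r_neq0/lgl_weight_gt0. Qed.

(** The left side is the quadrature of $(\ell_i\ell_j)'$, whose degree is at most 2N - 1. The rule
    is exact for it, so only the endpoint values of $\ell_i\ell_j$ remain. *)
Lemma lgl_sbp i j : omega i * D i j + omega j * D j i =
  (i == j)%:R * ((i == ord_max)%:R - (i == ord0)%:R).
Proof.
have -> : omega i * D i j + omega j * D j i =
    \sum_m omega m * ((l i * l j)^`()).[xi m].
  under eq_bigr => m _ do rewrite derivM hornerD !hornerM !horner_lagrange mulrDr.
  rewrite big_split /= (bigD1 j) //= big1 ?addr0 => [|m neq]; last first.
    by rewrite (negPf neq) !mulr0.
  rewrite [X in _ = _ + X](bigD1 i) //= [X in _ = _ + (_ + X)]big1 ?addr0 => [|m neq]; last first.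
    by rewrite (negPf neq) mul0r mulr0.
  by rewrite !eqxx mulr1 mul1r !mxE addrC.
rewrite lgl_quadrature_exact; last first.
  have [->|lij0] := eqVneq (l i * l j) 0; first by rewrite deriv0 size_poly0.
  rewrite -ltnS (leq_trans (lt_size_deriv lij0)) //.
  rewrite (leq_trans (size_polyMleq _ _)) //.
  by have := size_lagrange i; have := size_lagrange j; rewrite -addnn; lia.
have at_first p : p.[-1] = p.[xi ord0] by rewrite node_first.
have at_last p : p.[1] = p.[xi ord_max] by rewrite node_last.
rewrite pint_deriv at_first at_last !hornerM !horner_lagrange.
have delta_mul a : (a == i)%:R * (a == j)%:R = (i == j)%:R * (i == a)%:R :> R.
  rewrite (eq_sym i a); case: (eqVneq a i) => [->|_]; first by rewrite mul1r mulr1.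
  by rewrite mul0r mulr0.
by rewrite !delta_mul mulrBr.
Qed.

End Lobatto.

(** * Discrete metric identities *)

Section MetricIdentities.
Variables (R : realType) (N : nat) (xi : 'I_N.+1 -> R).
Hypotheses (N_gt0 : (0 < N)%N) (xi_lgl : lgl_nodes xi).

(** Freezing the inner variable gives a univariate polynomial in the outer one, to which exactness
    of the differentiation matrix applies. *)
Lemma horner2_map_eval (p : {poly {poly R}}) x y :
  p.[x, y] = (map_poly (horner_eval y) p).[x].
Proof. by rewrite -{2}(hornerC x y); exact: (esym (horner_map (horner_eval y) p x%:P)). Qed.

Lemma horner_map_deriv (p : {poly {poly R}}) x :
  (map_poly (@deriv R) p).[x%:P] = (p.[x%:P])^`().
Proof.
rewrite (horner_coef_wide _ (size_poly _ _)) [p.[_]]horner_coef raddf_sum /=.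
apply: eq_bigr => i _.
by rewrite coef_map_id0 ?deriv0 // derivM -rmorphXn /= derivC mulr0 addr0.
Qed.

Lemma deriv_map_deriv (p : {poly {poly R}}) :
  (map_poly (@deriv R) p)^`() = map_poly (@deriv R) p^`().
Proof.
apply/polyP => i; rewrite coef_deriv !coef_map_id0 ?deriv0 // coef_deriv.
by rewrite raddfMn.
Qed.

(** Both sides are the nodal values of the mixed derivative, since each of the two discrete
    derivatives is exact on polynomials of degree at most N in its variable. *)
Lemma lgl_metric_identity (p : {poly {poly R}}) :
  (size p <= N.+1)%N -> (sizeY p <= N.+1)%N ->
  lgl_diffmx xi *m nodal_deta xi p = nodal_dxi xi p *m (lgl_diffmx xi)^T.
Proof.
move=> szX szY; apply/matrixP => i j; rewrite !mxE.
transitivity (map_poly (@deriv R) p^`()).[xi i, xi j].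
  under eq_bigr => m _ do rewrite [nodal_deta _ _ _ _]mxE horner2_map_eval.
  rewrite (lgl_diffmx_exact N_gt0 xi_lgl) ?deriv_map ?deriv_map_deriv -?horner2_map_eval //.
  by rewrite (leq_trans (size_poly _ _)) // (leq_trans (size_poly _ _)).
under eq_bigr => m _ do rewrite [nodal_dxi _ _ _ _]mxE [(_)^T _ _]mxE mulrC.
rewrite (lgl_diffmx_exact N_gt0 xi_lgl) ?horner_map_deriv //.
apply: leq_trans (max_size_evalC _ _) (leq_trans _ szY).
apply/bigmax_leqP => m _; rewrite coef_deriv (leq_trans _ (max_size_coefXY p m.+1)) //.
by rewrite -scaler_nat size_scale_leq.
Qed.
End MetricIdentities.

(** * Two-point fluxes and summation by parts on a grid line *)

Lemma sum_ord3 (V : nmodType) (F : 'I_3 -> V) : \sum_k F k = F 0 + F 1 + F 2.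
Proof.
by rewrite !big_ord_recl big_ord0 addr0 addrA; congr (_ + F _ + F _); apply: val_inj.
Qed.

Section Pointwise.
Variables (R : realType) (g : R).
Implicit Types w : 'rV[R]_3.

Lemma momxE w : 0 < height w -> momx w = height w * velx w.
Proof. by move=> /lt0r_neq0 h0; rewrite /velx mulrC divfK. Qed.

Lemma momyE w : 0 < height w -> momy w = height w * vely w.
Proof. by move=> /lt0r_neq0 h0; rewrite /vely mulrC divfK. Qed.

Lemma vec3_0 (a b c : R) : vec3 a b c 0 0 = a. Proof. by rewrite mxE. Qed.
Lemma vec3_1 (a b c : R) : vec3 a b c 0 1 = b. Proof. by rewrite mxE. Qed.
Lemma vec3_2 (a b c : R) : vec3 a b c 0 2 = c. Proof. by rewrite mxE. Qed.
Lemma vec3N x y k : vec3 0 (- x) (- y) 0 k = - vec3 0 x y 0 k :> R.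
Proof. by case: k => -[|[|[|//]]] lek; rewrite !mxE /= ?oppr0. Qed.

Definition vec3E := (vec3_0, vec3_1, vec3_2).

(** The gradient of [energy] with respect to the conserved variables. *)
Definition entropy_vars w (b : R) : 'rV[R]_3 :=
  vec3 (g * (height w + b) - (velx w ^+ 2 + vely w ^+ 2) / 2) (velx w) (vely w).

(** With a scaled normal as parameter, both contravariant fluxes and all four sides are instances of
    one formula. *)
Definition flux_n (n : R * R) w (k : 'I_3) : R :=
  n.1 * flux_f g w 0 k + n.2 * flux_g g w 0 k.

Definition flux_vol_n (n : R * R) w1 w2 (k : 'I_3) : R :=
  n.1 * flux_f_vol g w1 w2 0 k + n.2 * flux_g_vol g w1 w2 0 k.

Definition flux_ec_n (n : R * R) w1 w2 (k : 'I_3) : R :=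
  n.1 * flux_f_ec g w1 w2 0 k + n.2 * flux_g_ec g w1 w2 0 k.

(** The entropy potential in direction [n]: entropy variables times flux, minus the energy flux. The
    bottom cancels in this difference. *)
Definition potential_n (n : R * R) w : R :=
  g / 2 * height w ^+ 2 * (n.1 * velx w + n.2 * vely w).

Lemma avgC (x y : R) : avg x y = avg y x.
Proof. by rewrite /avg addrC. Qed.

Lemma flux_vol_nC n w1 w2 k : flux_vol_n n w1 w2 k = flux_vol_n n w2 w1 k.
Proof.
by rewrite /flux_vol_n /flux_f_vol /flux_g_vol (avgC (momx w1) (momx w2))
  (avgC (momy w1) (momy w2)) (avgC (velx w1) (velx w2))
  (avgC (vely w1) (vely w2)) (avgC (height w1) (height w2)) (avgC (sqheight w1) (sqheight w2)).
Qed.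

Lemma flux_ec_nC n w1 w2 k : flux_ec_n n w1 w2 k = flux_ec_n n w2 w1 k.
Proof.
by rewrite /flux_ec_n /flux_f_ec /flux_g_ec (avgC (velx w1) (velx w2)) (avgC (vely w1) (vely w2))
  (avgC (height w1) (height w2)) (avgC (sqheight w1) (sqheight w2)).
Qed.

Lemma flux_ec_nN n w1 w2 k : flux_ec_n (- n) w1 w2 k = - flux_ec_n n w1 w2 k.
Proof. by rewrite /flux_ec_n /=; ring. Qed.

Lemma flux_vol_n_diag n w k : 0 < height w -> flux_vol_n n w w k = flux_n n w k.
Proof.
move=> h0; have hE := momxE h0; have hE' := momyE h0.
rewrite /flux_vol_n /flux_n /flux_f_vol /flux_g_vol /flux_f /flux_g /avg /sqheight.
by case: k => -[|[|[|//]]] lek; rewrite !mxE /= hE hE'; field.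
Qed.

(** Tadmor's condition for entropy conservation, up to a bottom term. That term contains mean
    momenta, which is the form that the volume source can offset. *)
Lemma entropy_jump_vol n w1 w2 b1 b2 : 0 < height w1 -> 0 < height w2 ->
  \sum_k (entropy_vars w1 b1 0 k - entropy_vars w2 b2 0 k) * flux_vol_n n w1 w2 k =
  potential_n n w1 - potential_n n w2
  + g * (b1 - b2) * (n.1 * avg (momx w1) (momx w2) + n.2 * avg (momy w1) (momy w2)).
Proof.
move=> /[dup] /momxE h1x /momyE h1y /[dup] /momxE h2x /momyE h2y.
rewrite sum_ord3 /flux_vol_n /entropy_vars /flux_f_vol /flux_g_vol !vec3E.
rewrite h1x h1y h2x h2y /potential_n /avg /sqheight.
by field.
Qed.

(** Here the bottom term is mean height times mean velocity, matching the interface source tested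
    with the velocities of the two sides. *)
Lemma entropy_jump_ec n w1 w2 b1 b2 :
  \sum_k (entropy_vars w1 b1 0 k - entropy_vars w2 b2 0 k) * flux_ec_n n w1 w2 k =
  potential_n n w1 - potential_n n w2
  + g * (b1 - b2) * avg (height w1) (height w2)
    * (n.1 * avg (velx w1) (velx w2) + n.2 * avg (vely w1) (vely w2)).
Proof.
rewrite sum_ord3 /flux_ec_n /entropy_vars /flux_f_ec /flux_g_ec !vec3E.
rewrite /potential_n /avg /sqheight.
by field.
Qed.

(** At rest only pressure is left: the flux difference is $\frac g2\{\!\{h\}\!\}(h_2-h_1)$ times the
    normal, and $b_2-b_1=h_1-h_2$. *)
Lemma face_rest n w1 w2 b1 b2 k : 0 < height w1 -> 0 < height w2 ->
  height w1 + b1 = height w2 + b2 ->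
  velx w1 = 0 -> vely w1 = 0 -> velx w2 = 0 -> vely w2 = 0 ->
  flux_ec_n n w1 w2 k - flux_n n w1 k
  + g / 2 * avg (height w1) (height w2) * vec3 0 n.1 n.2 0 k * (b2 - b1) = 0.
Proof.
move=> h1 h2 hb u1 v1 u2 v2.
have -> : b2 = height w1 + b1 - height w2 by rewrite hb addrC addKr.
rewrite /flux_ec_n /flux_n /flux_f_ec /flux_g_ec /flux_f /flux_g.
rewrite momxE // momyE // u1 v1 u2 v2 /avg /sqheight.
by case: k => -[|[|[|//]]] lek; rewrite !mxE /=; field.
Qed.

End Pointwise.

Section Lines.
Variables (R : realType) (N : nat) (g : R) (Q : 'I_N.+1 -> 'I_N.+1 -> R).
Hypothesis sbp : forall i m,
  Q i m + Q m i = (i == m)%:R * ((i == ord_max)%:R - (i == ord0)%:R).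
Hypothesis row_sum : forall i, \sum_m Q i m = 0.

(** Since [Q] annihilates constants, a sum $n_i+n_m$ of normals may be replaced by $n_m$ and
    conversely. *)
Lemma row_sum_shift i (f : 'I_N.+1 -> R) (x : R) :
  \sum_m Q i m * (x + f m) = \sum_m Q i m * f m.
Proof.
under eq_bigr => m _ do rewrite mulrDr.
by rewrite big_split /= -mulr_suml row_sum mul0r add0r.
Qed.

Lemma sum_boundary (f : 'I_N.+1 -> R) :
  \sum_i ((i == ord_max)%:R - (i == ord0)%:R) * f i = f ord_max - f ord0.
Proof.
under eq_bigr => i _ do rewrite mulrBl.
rewrite sumrB (bigD1 ord_max) //= [X in _ - X](bigD1 ord0) //=.
rewrite !eqxx !mul1r !big1 ?addr0 // => i /negPf->; exact: mul0r.
Qed.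

(* For symmetric fluxes t = 0; for entropy variables times fluxes t is an entropy
   potential. *)
Lemma sbp_sum (V : 'I_N.+1 -> 'I_N.+1 -> R) (t : 'I_N.+1 -> R) :
  (forall i m, V i m - V m i = t i - t m) ->
  \sum_i \sum_m Q i m * V i m =
    ((V ord_max ord_max - t ord_max) - (V ord0 ord0 - t ord0)) / 2.
Proof.
move=> Vt.
(* Transposing the two indices replaces [Q] by its transpose, that is by minus [Q] plus the boundary
   matrix. *)
have swap (f : 'I_N.+1 -> 'I_N.+1 -> R) : \sum_i \sum_m Q i m * f i m
    = f ord_max ord_max - f ord0 ord0 - \sum_i \sum_m Q i m * f m i.
  rewrite -(sum_boundary (fun i => f i i)) [X in _ - X]exchange_big /= -sumrB.
  apply: eq_bigr => i _; rewrite -[X in X - _]/(_ * _).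
  have -> : ((i == ord_max)%:R - (i == ord0)%:R) * f i i =
      \sum_m (Q i m + Q m i) * f i m.
    rewrite (bigD1 i) //= sbp eqxx mul1r big1 ?addr0 // => m neq_mi.
    by rewrite sbp eq_sym (negPf neq_mi) !mul0r.
  by rewrite -sumrB; apply: eq_bigr => m _; ring.
have t0 : \sum_i \sum_m Q i m * t i = 0.
  by rewrite big1 // => i _; rewrite -mulr_suml row_sum mul0r.
(* [e1] gives the sum of the double sums of [V i m] and [V m i]; [e3], with [t0] and [e2], gives
   their difference. *)
have e1 := swap V; have e2 := swap (fun i m => t i).
have e3 : \sum_i \sum_m Q i m * V i m - \sum_i \sum_m Q i m * V m i =
   \sum_i \sum_m Q i m * t i - \sum_i \sum_m Q i m * t m.
  rewrite -!sumrB; apply: eq_bigr => i _; rewrite -!sumrB; apply: eq_bigr => m _.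
  by rewrite -!mulrBr Vt.
by move: e1 e2 e3; rewrite t0; lra.
Qed.

Variables (w : 'I_N.+1 -> 'rV[R]_3) (b : 'I_N.+1 -> R) (n : 'I_N.+1 -> R * R).
Hypothesis w_gt0 : forall i, 0 < height (w i).

Definition mean_normal i m : R * R := (avg (n i).1 (n m).1, avg (n i).2 (n m).2).

(** Flux differencing together with the volume source of the same direction. The two product forms
    of the source, such as $y_\eta\circ Db$ and $D(y_\eta\circ b)$, combine into the kernel
    $(n_i+n_m)b_m$. *)
Definition line_term (k : 'I_3) i : R :=
  \sum_m Q i m * (2 * flux_vol_n g (mean_normal i m) (w i) (w m) k
    + g / 2 * height (w i) * vec3 0 ((n i).1 + (n m).1) ((n i).2 + (n m).2) 0 k * b m).

Lemma mean_normalC i m : mean_normal i m = mean_normal m i.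
Proof. by rewrite /mean_normal (avgC (n i).1) (avgC (n i).2). Qed.

Lemma mean_normal_diag i : mean_normal i i = n i.
Proof. by rewrite /mean_normal /avg; case: (n i) => x y /=; congr pair; field. Qed.

Lemma line_mass :
  \sum_i line_term 0 i = flux_n g (n ord_max) (w ord_max) 0 - flux_n g (n ord0) (w ord0) 0.
Proof.
rewrite /line_term (@sbp_sum _ (fun=> 0)) => [|i m].
  by rewrite !vec3E !mean_normal_diag !flux_vol_n_diag //; field.
by rewrite !vec3E flux_vol_nC mean_normalC; ring.
Qed.

(** With a constant bottom the source reduces to discrete derivatives of the normals, which are left
    to cancel against those of the other direction. *)
Lemma line_conservation k c : (forall i, b i = c) ->
  \sum_i line_term k i =
    flux_n g (n ord_max) (w ord_max) k - flux_n g (n ord0) (w ord0) k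
    + g / 2 * c * \sum_i height (w i) *
        vec3 0 (\sum_m Q i m * (n m).1) (\sum_m Q i m * (n m).2) 0 k.
Proof.
move=> bc.
have -> : flux_n g (n ord_max) (w ord_max) k - flux_n g (n ord0) (w ord0) k =
    \sum_i \sum_m Q i m * (2 * flux_vol_n g (mean_normal i m) (w i) (w m) k).
  rewrite (@sbp_sum _ (fun=> 0)) => [|i m].
    by rewrite !mean_normal_diag !flux_vol_n_diag //; field.
  by rewrite flux_vol_nC mean_normalC; ring.
rewrite mulr_sumr -big_split /=; apply: eq_bigr => i _.
rewrite /line_term; under [LHS]eq_bigr => m _ do rewrite bc mulrDr.
rewrite big_split /=; congr (_ + _).
case: k => -[|[|[|//]]] lek; rewrite mxE /=.
- by rewrite !mulr0 big1 // => m _; rewrite mxE /= !(mulr0, mul0r).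
- rewrite -(row_sum_shift i (fun m => (n m).1) (n i).1) !mulr_sumr; apply: eq_bigr => m _.
  by rewrite mxE /=; ring.
- rewrite -(row_sum_shift i (fun m => (n m).2) (n i).2) !mulr_sumr; apply: eq_bigr => m _.
  by rewrite mxE /=; ring.
Qed.

(** By the meaning of [potential_n], this is the energy flux in the direction [n i]. *)
Definition entropy_flux_defect i : R :=
  \sum_k entropy_vars g (w i) (b i) 0 k * flux_n g (n i) (w i) k - potential_n g (n i) (w i).

(* The metric derivatives on the right cancel between the two coordinate
   directions. *)
Lemma line_energy :
  \sum_i \sum_k entropy_vars g (w i) (b i) 0 k * line_term k i =
  entropy_flux_defect ord_max - entropy_flux_defect ord0
  + \sum_i (g / 2 * height (w i) * (height (w i) + b i)) *
      (velx (w i) * \sum_m Q i m * (n m).1 + vely (w i) * \sum_m Q i m * (n m).2).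
Proof.
pose psi i := g / 2 * height (w i) * (height (w i) + b i).
(* By the jump condition, antisymmetrizing the tested flux and source gives
   $(n_i+n_m)\cdot(\psi_i\vec u_i-\psi_m\vec u_m)$, where $\vec u=(u,v)$. Subtracting the cross
   terms $\psi_i\vec u_i\cdot n_m$ leaves the telescoping difference of $\psi_i\vec u_i\cdot n_i$;
   the subtracted part is the metric sum of the statement. *)
pose V i m := \sum_k entropy_vars g (w i) (b i) 0 k *
    (2 * flux_vol_n g (mean_normal i m) (w i) (w m) k
    + g / 2 * height (w i) * vec3 0 ((n i).1 + (n m).1) ((n i).2 + (n m).2) 0 k * b m)
  - psi i * (velx (w i) * (n m).1 + vely (w i) * (n m).2).
have -> : entropy_flux_defect ord_max - entropy_flux_defect ord0 =
    \sum_i \sum_m Q i m * V i m.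
  rewrite (@sbp_sum V (fun i => psi i * (velx (w i) * (n i).1 + vely (w i) * (n i).2))).
    have diag i : V i i - psi i * (velx (w i) * (n i).1 + vely (w i) * (n i).2) =
        2 * entropy_flux_defect i.
      rewrite /V /entropy_flux_defect !sum_ord3 mean_normal_diag !flux_vol_n_diag //.
      by rewrite !vec3E /psi /potential_n; field.
    by rewrite !diag; field.
  move=> i m; rewrite /V !sum_ord3 !(flux_vol_nC _ _ (w m) (w i)) (mean_normalC m i).
  have := entropy_jump_vol g (mean_normal i m) (b i) (b m) (w_gt0 i) (w_gt0 m).
  rewrite sum_ord3 !momxE // !momyE // => /eqP; rewrite -subr_eq0 => /eqP E.
  have lincomb (x y : R) : x = 0 -> y = 2 * x -> y = 0 by move=> -> ->; rewrite mulr0.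
  apply/eqP; rewrite -subr_eq0; apply/eqP; apply: lincomb E _.
  rewrite !vec3E /psi /potential_n /mean_normal /avg /=.
  by move: (flux_vol_n _ _ _ _ _) (flux_vol_n _ _ _ _ _) (flux_vol_n _ _ _ _ _) => F0 F1 F2; field.
rewrite -big_split /=; apply: eq_bigr => i _; rewrite /V /line_term !sum_ord3.
rewrite !mulr_sumr -!big_split /= mulr_sumr -big_split /=; apply: eq_bigr => m _.
by rewrite sum_ord3 /psi; ring.
Qed.

(** At rest the two-point pressure is exactly $g h_ih_m/2$. The source with $b_m=c-h_m$ cancels it
    and leaves only the constant [c] times a discrete derivative of the normals. *)
Lemma line_rest c k i : (forall i, height (w i) + b i = c) ->
  (forall i, velx (w i) = 0) -> (forall i, vely (w i) = 0) ->
  line_term k i = g / 2 * c * height (w i) *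
    vec3 0 (\sum_m Q i m * (n m).1) (\sum_m Q i m * (n m).2) 0 k.
Proof.
move=> hb u0 v0.
have bE m : b m = c - height (w m) by rewrite -(hb m) addrC addKr.
rewrite -(row_sum_shift i (fun m => (n m).1) (n i).1) -(row_sum_shift i (fun m => (n m).2) (n i).2).
rewrite /line_term /flux_vol_n /flux_f_vol /flux_g_vol.
under eq_bigr => m _ do rewrite bE !momxE // !momyE // !u0 !v0.
case: k => -[|[|[|//]]] lek; rewrite [in RHS]mxE /= ?mulr0 ?mulr_sumr.
- by rewrite big1 // => m _; rewrite !mxE /= /avg; ring.
- by apply: eq_bigr => m _; rewrite !mxE /= /avg /sqheight; field.
- by apply: eq_bigr => m _; rewrite !mxE /= /avg /sqheight; field.
Qed.

End Lines.

(** * Weak form of the scheme on an element *)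

(** The bijection with pairs of booleans makes the sides a finite type, so that one can sum over
    them. *)
Definition side_bools (s : side) : bool * bool :=
  match s with
  | West => (false, false) | East => (false, true)
  | South => (true, false) | North => (true, true)
  end.
Definition bools_side (c : bool * bool) : side :=
  match c with
  | (false, false) => West | (false, true) => East
  | (true, false) => South | (true, true) => North
  end.
Lemma side_boolsK : cancel side_bools bools_side. Proof. by case. Qed.
Lemma bools_sideK : cancel bools_side side_bools. Proof. by case=> -[] []. Qed.
HB.instance Definition _ := Finite.copy side (can_type side_boolsK).

Lemma sum_side (V : nmodType) (F : side -> V) :
  \sum_s F s = F West + F East + (F South + F North).
Proof.
rewrite (reindex bools_side) /=; last first.
  by exists side_bools => s _; rewrite ?side_boolsK ?bools_sideK.
transitivity (\sum_c F (bools_side (c.1, c.2))); first by apply: eq_bigr => -[].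
rewrite -(pair_bigA _ (fun c d => F (bools_side (c, d)))) /= !big_bool /=.
by rewrite addrC; congr (_ + _); rewrite addrC.
Qed.

Section Elements.
Variables (R : realType) (N : nat) (xi : 'I_N.+1 -> R) (T : mesh xi) (g : R).
Hypotheses (N_gt0 : (0 < N)%N) (xi_lgl : lgl_nodes xi).

Local Notation omega := (lgl_weight xi).
Local Notation D := (lgl_diffmx xi).

Definition sbp_coef i m : R := omega i * D i m.
Local Notation Q := sbp_coef.

Lemma sbp_coef_sbp i m :
  Q i m + Q m i = (i == m)%:R * ((i == ord_max)%:R - (i == ord0)%:R).
Proof. exact: lgl_sbp. Qed.

Lemma sbp_coef_row_sum i : \sum_m Q i m = 0.
Proof.
have := lgl_diffmx_exact N_gt0 xi_lgl i (p := 1%:P).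
rewrite size_polyC oner_neq0 derivC horner0 => /(_ isT) E.
transitivity (omega i * \sum_m D i m * (1%:P : {poly R}).[xi m]); last by rewrite E mulr0.
by rewrite mulr_sumr; apply: eq_bigr => m _; rewrite hornerC mulr1.
Qed.

Definition normal_xi (K : elem T) i j : R * R := (y_eta K i j, - x_eta K i j).
Definition normal_eta (K : elem T) i j : R * R := (- y_xi K i j, x_xi K i j).

(** The metric identity multiplied by both weights, in the form in which the line sums of the two
    directions meet at a node. *)
Lemma metric_identity1 K i j :
  omega j * \sum_m Q i m * (normal_xi K m j).1
  + omega i * \sum_m Q j m * (normal_eta K i m).1 = 0.
Proof.
have [_ _ szX szY] := mesh_degree K.
have /matrixP/(_ i j) := lgl_metric_identity N_gt0 xi_lgl szX szY; rewrite !mxE => E.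
have -> : \sum_m Q i m * (normal_xi K m j).1 = omega i * \sum_m D i m * y_eta K m j.
  by rewrite mulr_sumr; apply: eq_bigr => m _; rewrite mulrA.
have -> : \sum_m Q j m * (normal_eta K i m).1 =
    - (omega j * \sum_m y_xi K i m * D^T m j).
  by rewrite mulr_sumr -sumrN; apply: eq_bigr => m _; rewrite [D^T _ _]mxE /Q /=; ring.
by rewrite E; ring.
Qed.

Lemma metric_identity2 K i j :
  omega j * \sum_m Q i m * (normal_xi K m j).2
  + omega i * \sum_m Q j m * (normal_eta K i m).2 = 0.
Proof.
have [szX szY _ _] := mesh_degree K.
have /matrixP/(_ i j) := lgl_metric_identity N_gt0 xi_lgl szX szY; rewrite !mxE => E.
have -> : \sum_m Q i m * (normal_xi K m j).2 = - (omega i * \sum_m D i m * x_eta K m j).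
  by rewrite mulr_sumr -sumrN; apply: eq_bigr => m _; rewrite /Q /=; ring.
have -> : \sum_m Q j m * (normal_eta K i m).2 =
    omega j * \sum_m x_xi K i m * D^T m j.
  by rewrite mulr_sumr; apply: eq_bigr => m _; rewrite [D^T _ _]mxE /Q /=; ring.
by rewrite E; ring.
Qed.

Local Notation face := (elem T * side)%type.

Definition face_normal (f : face) m := outward_normal xi (mapx f.1) (mapy f.1) f.2 m.

Definition paired (f : face) (m : 'I_N.+1) := if flip f then rev_ord m else m.

Definition inner (V : Type) (A : elem T -> 'I_N.+1 -> 'I_N.+1 -> V) (f : face) m : V :=
  A f.1 (side_node f.2 m).1 (side_node f.2 m).2.

Lemma outerE (V : Type) (A : elem T -> 'I_N.+1 -> 'I_N.+1 -> V) K s m :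
  outer A K s m = inner A (nbr (K, s)) (paired (K, s) m).
Proof. by rewrite /outer /inner /paired; case: side_node. Qed.

Variables (b : elem T -> 'M[R]_N.+1) (W : nodal_field T).
Local Notation st := (inner (state W)).
Local Notation bt := (inner (fun K i j => b K i j)).

Definition face_flux_ec k (f : face) m : R :=
  flux_ec_n g (face_normal f m) (st f m) (st (nbr f) (paired f m)) k.

(** The outward normal and the jump taken as outer minus inner absorb the side-dependent signs of
    [side_jump] and of the surface matrix, so all sides share this expression. *)
Definition face_term k (f : face) m : R :=
  face_flux_ec k f m - flux_n g (face_normal f m) (st f m) k
  + g / 2 * avg (height (st f m)) (height (st (nbr f) (paired f m)))
    * vec3 0 (face_normal f m).1 (face_normal f m).2 0 k
    * (bt (nbr f) (paired f m) - bt f m).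

Definition line_xi K k i j : R :=
  line_term g Q (fun i => state W K i j) (fun i => b K i j) (fun i => normal_xi K i j) k i.
Definition line_eta K k i j : R :=
  line_term g Q (fun j => state W K i j) (fun j => b K i j) (fun j => normal_eta K i j) k j.

Lemma invmx_massmx : invmx (lgl_massmx xi) = diag_mx (\row_i (omega i)^-1).
Proof.
have MV : lgl_massmx xi *m diag_mx (\row_i (omega i)^-1) = 1%:M.
  apply/matrixP => i j; rewrite mul_diag_mx !mxE; case: (eqVneq i j) => [->|_].
    by rewrite mulr1n divff ?(lgl_weight_neq0 N_gt0 xi_lgl).
  by rewrite mulr0n mulr0.
have [Mu _] := mulmx1_unit MV.
by rewrite -[LHS]mulmx1 -MV mulKmx.
Qed.

Lemma heightE K i j : height (state W K i j) = W K 0 i j.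
Proof. by rewrite /height mxE. Qed.

(** The two momentum sources are the two components of one expression in the normals; writing it
    with [vec3] also covers the zero mass source. *)
Lemma source_entry K k i j :
  source g b W K k i j =
  - (g / 2) * W K 0 i j *
    (\sum_m D i m * vec3 0 ((normal_xi K i j).1 + (normal_xi K m j).1)
                           ((normal_xi K i j).2 + (normal_xi K m j).2) 0 k * b K m j
     + \sum_m D j m * vec3 0 ((normal_eta K i j).1 + (normal_eta K i m).1)
                           ((normal_eta K i j).2 + (normal_eta K i m).2) 0 k * b K i m)
  - g / 2 * (omega i)^-1 * vec3 0 (normal_xi K i j).1 (normal_xi K i j).2 0 k
    * xi_sides (side_avg (fun L => W L 0) K) i j * xi_sides (side_jump b K) i j
  - g / 2 * (omega j)^-1 * vec3 0 (normal_eta K i j).1 (normal_eta K i j).2 0 k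
    * eta_sides (side_avg (fun L => W L 0) K) i j * eta_sides (side_jump b K) i j.
Proof.
rewrite /source /source2 /source3 invmx_massmx /normal_xi /normal_eta /=.
set AX := xi_sides (side_avg _ _); set JX := xi_sides (side_jump _ _).
set AE := eta_sides (side_avg _ _); set JE := eta_sides (side_jump _ _).
move: AX JX AE JE => AX JX AE JE.
move: (y_eta K) (x_eta K) (y_xi K) (x_xi K) (b K) (lgl_diffmx xi) (W K 0).
move=> ye xe yx xx B Dm h.
rewrite !mul_diag_mx !mul_mx_diag.
case: k => -[|[|[|//]]] lek /=; rewrite !mxE /=.
- by rewrite !big1; [ring|move=> m _; rewrite mxE /=; ring..].
- have -> : \sum_m Dm i m * vec3 0 (ye i j + ye m j) (- xe i j - xe m j) 0 (Ordinal lek) * B m j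
      = ye i j * (\sum_m Dm i m * B m j) + \sum_m Dm i m * (ye ⊙ B) m j.
    rewrite mulr_sumr -big_split /=; apply: eq_bigr => m _.
    by rewrite !mxE /=; ring.
  have -> : \sum_m Dm j m * vec3 0 (- yx i j - yx i m) (xx i j + xx i m) 0 (Ordinal lek) * B i m
      = - (yx i j * (\sum_m B i m * Dm^T m j)) - \sum_m (yx ⊙ B) i m * Dm^T m j.
    rewrite mulr_sumr -!sumrN -big_split /=; apply: eq_bigr => m _.
    by rewrite !mxE /=; ring.
  by ring.
- have -> : \sum_m Dm i m * vec3 0 (ye i j + ye m j) (- xe i j - xe m j) 0 (Ordinal lek) * B m j
      = - (xe i j * (\sum_m Dm i m * B m j)) - \sum_m Dm i m * (xe ⊙ B) m j.
    rewrite mulr_sumr -!sumrN -big_split /=; apply: eq_bigr => m _.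
    by rewrite !mxE /=; ring.
  have -> : \sum_m Dm j m * vec3 0 (- yx i j - yx i m) (xx i j + xx i m) 0 (Ordinal lek) * B i m
      = xx i j * (\sum_m B i m * Dm^T m j) + \sum_m (xx ⊙ B) i m * Dm^T m j.
    rewrite mulr_sumr -big_split /=; apply: eq_bigr => m _.
    by rewrite !mxE /=; ring.
  by ring.
Qed.

(** The surface matrix has opposite signs at the two ends, and so does the outward normal relative
    to [normal_xi]; hence both ends enter with the same sign. *)
Lemma xi_faces_entry K k i j :
  omega i * omega j *
    ((lgl_surfmx xi *m (Ftilde_ec g W K k - Ftilde g W K k)) i j
     - g / 2 * (omega i)^-1 * vec3 0 (normal_xi K i j).1 (normal_xi K i j).2 0 k
       * xi_sides (side_avg (fun L => W L 0) K) i j * xi_sides (side_jump b K) i j)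
  = - omega j * ((i == ord_max)%:R * face_term k (K, East) j
                 + (i == ord0)%:R * face_term k (K, West) j).
Proof.
have surfE (A B : 'M[R]_N.+1) : (lgl_surfmx xi *m (A - B)) i j =
    (if i == ord0 then (omega ord0)^-1 else if i == ord_max then - (omega ord_max)^-1
     else 0) * (A i j - B i j).
  by rewrite mul_diag_mx !mxE.
have sidesE (a : side -> 'I_N.+1 -> R) : xi_sides a i j =
    if i == ord0 then a West j else if i == ord_max then a East j else 0.
  by rewrite mxE.
rewrite surfE !sidesE [Ftilde _ _ _ _ _ _]mxE.
have := lgl_weight_neq0 N_gt0 xi_lgl i.
case: (eqVneq i ord0) => [->|_] wi0.
  rewrite (negPf (ord0_neq_max N_gt0)) mul0r add0r mul1r.
  rewrite /face_term /face_flux_ec /face_normal /outward_normal /flux_n /flux_ec_n /= vec3N.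
  rewrite /side_avg /side_jump /at_side /= /Fstar /Gstar /= !outerE !heightE.
  by rewrite /inner /normal_xi /y_eta /x_eta /=; field.
rewrite mul0r addr0; move: wi0; case: (eqVneq i ord_max) => [->|_] wi0; last first.
  by rewrite !(mul0r, mulr0, subr0).
rewrite mul1r.
rewrite /face_term /face_flux_ec /face_normal /outward_normal /flux_n /flux_ec_n /=.
rewrite /side_avg /side_jump /at_side /= /Fstar /Gstar /= !outerE !heightE.
by rewrite /inner /normal_xi /y_eta /x_eta /=; field.
Qed.

Lemma eta_faces_entry K k i j :
  omega i * omega j *
    (((Gtilde_ec g W K k - Gtilde g W K k) *m lgl_surfmx xi) i j
     - g / 2 * (omega j)^-1 * vec3 0 (normal_eta K i j).1 (normal_eta K i j).2 0 k
       * eta_sides (side_avg (fun L => W L 0) K) i j * eta_sides (side_jump b K) i j)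
  = - omega i * ((j == ord_max)%:R * face_term k (K, North) i
                 + (j == ord0)%:R * face_term k (K, South) i).
Proof.
have surfE (A B : 'M[R]_N.+1) : ((A - B) *m lgl_surfmx xi) i j =
    (if j == ord0 then (omega ord0)^-1 else if j == ord_max then - (omega ord_max)^-1
     else 0) * (A i j - B i j).
  by rewrite mul_mx_diag !mxE mulrC.
have sidesE (a : side -> 'I_N.+1 -> R) : eta_sides a i j =
    if j == ord0 then a South i else if j == ord_max then a North i else 0.
  by rewrite mxE.
rewrite surfE !sidesE [Gtilde _ _ _ _ _ _]mxE.
have := lgl_weight_neq0 N_gt0 xi_lgl j.
case: (eqVneq j ord0) => [->|_] wj0.
  rewrite (negPf (ord0_neq_max N_gt0)) mul0r add0r mul1r.
  rewrite /face_term /face_flux_ec /face_normal /outward_normal /flux_n /flux_ec_n /= vec3N.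
  rewrite /side_avg /side_jump /at_side /= /Fstar /Gstar /= !outerE !heightE.
  by rewrite /inner /normal_eta /y_xi /x_xi /=; field.
rewrite mul0r addr0; move: wj0; case: (eqVneq j ord_max) => [->|_] wj0; last first.
  by rewrite !(mul0r, mulr0, subr0).
rewrite mul1r.
rewrite /face_term /face_flux_ec /face_normal /outward_normal /flux_n /flux_ec_n /=.
rewrite /side_avg /side_jump /at_side /= /Fstar /Gstar /= !outerE !heightE.
by rewrite /inner /normal_eta /y_xi /x_xi /=; field.
Qed.

Variable Wt : nodal_field T.
Hypothesis scheme : ecdgsem g b W Wt.

Lemma scheme_entry K k i j :
  omega i * omega j * Jac K i j * Wt K k i j =
  - (omega j * (line_xi K k i j + ((i == ord_max)%:R * face_term k (K, East) j
                                   + (i == ord0)%:R * face_term k (K, West) j)))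
  - omega i * (line_eta K k i j + ((j == ord_max)%:R * face_term k (K, North) i
                                   + (j == ord0)%:R * face_term k (K, South) i)).
Proof.
have addE (A B : 'M[R]_N.+1) : (A + B) i j = A i j + B i j by rewrite mxE.
have := scheme K k; move: (Jac K) => J /matrixP/(_ i j); rewrite !addE.
have -> : (J ⊙ Wt K k) i j = J i j * Wt K k i j by rewrite mxE.
have := xi_faces_entry K k i j; have := eta_faces_entry K k i j.
rewrite source_entry.
have QE i' m : lgl_sbpmx xi i' m = Q i' m by rewrite /lgl_sbpmx mul_diag_mx mxE [(\row__ _) _ _]mxE.
(* The factor [omega i] cancels the inverse weight in the flux differencing, and the volume source
   joins it. *)
have line_xiE : line_xi K k i j = omega i * (volume_P g W K k i j + g / 2 * W K 0 i j *
    \sum_m D i m * vec3 0 ((normal_xi K i j).1 + (normal_xi K m j).1)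
                           ((normal_xi K i j).2 + (normal_xi K m j).2) 0 k * b K m j).
  rewrite mulrDr [volume_P _ _ _ _ _ _]mxE mulVKf ?(lgl_weight_neq0 N_gt0 xi_lgl) //.
  rewrite !mulr_sumr -big_split /=; apply: eq_bigr => m _.
  by rewrite QE heightE /flux_vol_n /mean_normal /Q /avg /=; field.
have line_etaE : line_eta K k i j = omega j * (volume_R g W K k i j + g / 2 * W K 0 i j *
    \sum_m D j m * vec3 0 ((normal_eta K i j).1 + (normal_eta K i m).1)
                           ((normal_eta K i j).2 + (normal_eta K i m).2) 0 k * b K i m).
  rewrite mulrDr [volume_R _ _ _ _ _ _]mxE mulVKf ?(lgl_weight_neq0 N_gt0 xi_lgl) //.
  rewrite !mulr_sumr -big_split /=; apply: eq_bigr => m _.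
  by rewrite QE heightE /flux_vol_n /mean_normal /Q /avg /=; field.
have lincomb (x1 y1 x2 y2 x3 y3 x y c : R) : x1 = y1 -> x2 = y2 -> x3 = y3 ->
    x - y = c * (x1 - y1) + (x2 - y2) + (x3 - y3) -> x = y.
  by move=> -> -> -> /eqP; rewrite !subrr mulr0 !addr0 subr_eq0 => /eqP.
rewrite line_xiE line_etaE => Eeta Exi E.
by apply: (lincomb _ _ _ _ _ _ _ _ (omega i * omega j) E Exi Eeta); ring.
Qed.

(** Turns end-minus-start differences along grid lines into a sum over the sides with outward
    normals; oddness in the normal accounts for the minus signs. *)
Lemma boundary_sum (psi : R * R -> 'I_N.+1 -> 'I_N.+1 -> R) K :
  (forall n i j, psi (- n) i j = - psi n i j) ->
  \sum_j omega j * (psi (normal_xi K ord_max j) ord_max j - psi (normal_xi K ord0 j) ord0 j)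
  + \sum_i omega i * (psi (normal_eta K i ord_max) i ord_max
                       - psi (normal_eta K i ord0) i ord0)
  = \sum_s \sum_m omega m *
      psi (face_normal (K, s) m) (side_node s m).1 (side_node s m).2.
Proof.
move=> psiN; rewrite sum_side -!big_split /=; apply: eq_bigr => m _.
rewrite /face_normal /outward_normal /= !psiN /normal_xi /normal_eta.
by rewrite /y_eta /x_eta /y_xi /x_xi; ring.
Qed.

(** The discrete weak form. The test array 1 gives conservation, and the entropy variables give the
    energy balance. *)
Lemma scheme_weak K k (phi : 'I_N.+1 -> 'I_N.+1 -> R) :
  \sum_i \sum_j phi i j * (omega i * omega j * Jac K i j * Wt K k i j) =
  - (\sum_j omega j * \sum_i phi i j * line_xi K k i j)
  - (\sum_i omega i * \sum_j phi i j * line_eta K k i j)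
  - \sum_s \sum_m omega m * (phi (side_node s m).1 (side_node s m).2 * face_term k (K, s) m).
Proof.
have pick (a : 'I_N.+1) (f : 'I_N.+1 -> R) : \sum_i (i == a)%:R * f i = f a.
  rewrite (bigD1 a) //= eqxx mul1r big1 ?addr0 // => i /negPf->; exact: mul0r.
have -> : \sum_s \sum_m omega m *
    (phi (side_node s m).1 (side_node s m).2 * face_term k (K, s) m) =
  \sum_j omega j * (\sum_i phi i j * ((i == ord_max)%:R * face_term k (K, East) j
                                   + (i == ord0)%:R * face_term k (K, West) j))
  + \sum_i omega i * (\sum_j phi i j * ((j == ord_max)%:R * face_term k (K, North) i
                                   + (j == ord0)%:R * face_term k (K, South) i)).
  rewrite sum_side -!big_split /=; apply: eq_bigr => m _.
  under [in RHS]eq_bigr => i _ do rewrite mulrDr !(mulrCA (phi i m)).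
  under [X in _ = _ + _ * X]eq_bigr => i _ do rewrite mulrDr !(mulrCA (phi m i)).
  by rewrite !big_split /= !pick; ring.
have -> : \sum_i \sum_j phi i j * (omega i * omega j * Jac K i j * Wt K k i j) =
    \sum_j \sum_i - (omega j * (phi i j * (line_xi K k i j
              + ((i == ord_max)%:R * face_term k (K, East) j
                 + (i == ord0)%:R * face_term k (K, West) j)))) +
    \sum_i \sum_j - (omega i * (phi i j * (line_eta K k i j
              + ((j == ord_max)%:R * face_term k (K, North) i
                 + (j == ord0)%:R * face_term k (K, South) i)))).
  rewrite exchange_big /= [X in _ = X + _]exchange_big /= [X in X = _]exchange_big /=.
  rewrite -big_split /=; apply: eq_bigr => i _; rewrite -big_split /=; apply: eq_bigr => j _.
  by rewrite scheme_entry; ring.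
have distr (A B : 'I_N.+1 -> 'I_N.+1 -> R) (c : 'I_N.+1 -> R) (p : 'I_N.+1 -> 'I_N.+1 -> R) :
    \sum_j \sum_i - (c j * (p i j * (A i j + B i j))) =
    - (\sum_j c j * \sum_i p i j * A i j) - \sum_j c j * \sum_i p i j * B i j.
  rewrite -opprD -big_split /= -sumrN; apply: eq_bigr => j _.
  rewrite -mulrDr -big_split /= mulr_sumr -sumrN; apply: eq_bigr => i _.
  by rewrite mulrDr.
rewrite distr (distr (fun j i => line_eta K k i j) _ omega (fun j i => phi i j)).
by ring.
Qed.

Hypothesis W_gt0 : positive_heights W.

Lemma flux_nN n w k : flux_n g (- n) w k = - flux_n g n w k.
Proof. by rewrite /flux_n /=; ring. Qed.

Lemma lines_conservation K k : k = 0 \/ (exists c, forall K, b K = const_mx c) ->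
  \sum_j omega j * \sum_i line_xi K k i j + \sum_i omega i * \sum_j line_eta K k i j =
  \sum_s \sum_m omega m * flux_n g (face_normal (K, s) m) (st (K, s) m) k.
Proof.
rewrite -(boundary_sum (psi := fun n i j => flux_n g n (state W K i j) k)); last first.
  by move=> n i j; exact: flux_nN.
case=> [->|[c bc]].
  congr (_ + _); apply: eq_bigr => i _; congr (_ * _).
    exact: (line_mass _ sbp_coef_sbp sbp_coef_row_sum _ _ (fun i' => W_gt0 K i' i)).
  exact: (line_mass _ sbp_coef_sbp sbp_coef_row_sum _ _ (W_gt0 K i)).
have bK i j : b K i j = c by rewrite bc mxE.
under eq_bigr => j _.
  rewrite (line_conservation _ sbp_coef_sbp sbp_coef_row_sum _ (fun i => W_gt0 K i j) _
            (fun i => bK i j)).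
  rewrite mulrDr; over.
under [X in _ + X = _]eq_bigr => i _.
  rewrite (line_conservation _ sbp_coef_sbp sbp_coef_row_sum _ (W_gt0 K i) _ (bK i)).
  rewrite mulrDr; over.
rewrite !big_split /= addrACA -[RHS]addr0; congr (_ + _).
(* Collecting the leftovers of both directions node by node exposes the metric identities. *)
transitivity (\sum_i \sum_j g / 2 * c * height (state W K i j) *
   vec3 0 (omega j * \sum_m Q i m * (normal_xi K m j).1
  + omega i * \sum_m Q j m * (normal_eta K i m).1)
  (omega j * \sum_m Q i m * (normal_xi K m j).2
  + omega i * \sum_m Q j m * (normal_eta K i m).2) 0 k).
  rewrite [in RHS]exchange_big /=.
  under eq_bigr => j _ do rewrite mulrCA mulr_sumr mulr_sumr.
  under [X in _ + X]eq_bigr => i _ do rewrite mulrCA mulr_sumr mulr_sumr.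
  rewrite [X in _ + X]exchange_big -big_split /=; apply: eq_bigr => j _.
  rewrite -big_split /=; apply: eq_bigr => i _.
  by case: k => -[|[|[|//]]] lek; rewrite !mxE /=; ring.
rewrite big1 // => i _; rewrite big1 // => j _.
rewrite metric_identity1 metric_identity2.
by case: k => -[|[|[|//]]] lek; rewrite !mxE /= mulr0.
Qed.

(** The line sums yield the inner fluxes on the sides, which cancel those subtracted in [face_term];
    the bottom jump vanishes for the mass and for a constant bottom. *)
Lemma element_conservation K k : k = 0 \/ (exists c, forall K, b K = const_mx c) ->
  \sum_i \sum_j omega i * omega j * Jac K i j * Wt K k i j =
  - \sum_s \sum_m omega m * face_flux_ec k (K, s) m.
Proof.
move=> kb; pose one := fun _ _ : 'I_N.+1 => 1 : R.
transitivity (\sum_i \sum_j one i j * (omega i * omega j * Jac K i j * Wt K k i j)).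
  by apply: eq_bigr => i _; apply: eq_bigr => j _; rewrite mul1r.
have sum1 (A : 'I_N.+1 -> R) : \sum_i 1 * A i = \sum_i A i.
  by apply: eq_bigr => i _; rewrite mul1r.
rewrite scheme_weak /one; under eq_bigr => j _ do rewrite sum1.
under [X in _ - X - _]eq_bigr => i _ do rewrite sum1.
rewrite -opprD lines_conservation // -opprD; congr (- _).
rewrite -big_split /=; apply: eq_bigr => s _; rewrite -big_split /=; apply: eq_bigr => m _.
rewrite mul1r -mulrDr /face_term; congr (_ * _).
have -> : g / 2 * avg (height (st (K, s) m)) (height (st (nbr (K, s)) (paired (K, s) m)))
    * vec3 0 (face_normal (K, s) m).1 (face_normal (K, s) m).2 0 k
    * (bt (nbr (K, s)) (paired (K, s) m) - bt (K, s) m) = 0.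
  case: kb => [->|[c bc]]; first by rewrite vec3_0 mulr0 mul0r.
  by rewrite /inner !bc !mxE subrr mulr0.
by rewrite addr0 addrC subrK.
Qed.

(** What a face contributes to the energy balance: the inner flux cancels between the line sums and
    [face_term], leaving the tested numerical flux, the potential and the tested interface
    source. *)
Definition face_energy (f : face) m : R :=
  \sum_k entropy_vars g (st f m) (bt f m) 0 k * face_flux_ec k f m
  - potential_n g (face_normal f m) (st f m)
  + g / 2 * avg (height (st f m)) (height (st (nbr f) (paired f m)))
    * ((face_normal f m).1 * velx (st f m) + (face_normal f m).2 * vely (st f m))
    * (bt (nbr f) (paired f m) - bt f m).

Lemma lines_energy K :
  \sum_j omega j * \sum_i \sum_k
     entropy_vars g (state W K i j) (b K i j) 0 k * line_xi K k i j
  + \sum_i omega i * \sum_j \sum_k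
     entropy_vars g (state W K i j) (b K i j) 0 k * line_eta K k i j =
  \sum_s \sum_m omega m *
   (\sum_k entropy_vars g (st (K, s) m) (bt (K, s) m) 0 k
               * flux_n g (face_normal (K, s) m) (st (K, s) m) k
    - potential_n g (face_normal (K, s) m) (st (K, s) m)).
Proof.
rewrite -(boundary_sum (psi := fun n i j =>
   \sum_k entropy_vars g (state W K i j) (b K i j) 0 k * flux_n g n (state W K i j) k
   - potential_n g n (state W K i j))); last first.
  by move=> n i j; rewrite !sum_ord3 /potential_n !flux_nN /=; ring.
under eq_bigr => j _ do rewrite
  (line_energy _ sbp_coef_sbp sbp_coef_row_sum _ _ (fun i => W_gt0 K i j)) mulrDr.
under [X in _ + X = _]eq_bigr => i _ do rewrite
  (line_energy _ sbp_coef_sbp sbp_coef_row_sum _ _ (W_gt0 K i)) mulrDr.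
rewrite !big_split /= addrACA -[RHS]addr0; congr (_ + _).
pose p i j := g / 2 * height (state W K i j) * (height (state W K i j) + b K i j).
transitivity (\sum_i \sum_j p i j *
  (velx (state W K i j) * (omega j * \sum_m Q i m * (normal_xi K m j).1
  + omega i * \sum_m Q j m * (normal_eta K i m).1) +
  vely (state W K i j) * (omega j * \sum_m Q i m * (normal_xi K m j).2
  + omega i * \sum_m Q j m * (normal_eta K i m).2))).
  rewrite [in RHS]exchange_big /=.
  under eq_bigr => j _ do rewrite mulr_sumr.
  under [X in _ + X]eq_bigr => i _ do rewrite mulr_sumr.
  rewrite [X in _ + X]exchange_big -big_split /=; apply: eq_bigr => j _.
  by rewrite -big_split /=; apply: eq_bigr => i _; rewrite /p; ring.
rewrite big1 // => i _; rewrite big1 // => j _.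
by rewrite metric_identity1 metric_identity2 !mulr0 addr0 mulr0.
Qed.

Lemma element_energy K :
  \sum_i \sum_j omega i * omega j * Jac K i j *
    \sum_k entropy_vars g (state W K i j) (b K i j) 0 k * Wt K k i j =
  - \sum_s \sum_m omega m * face_energy (K, s) m.
Proof.
pose q k i j := entropy_vars g (state W K i j) (b K i j) 0 k.
transitivity (\sum_k \sum_i \sum_j q k i j * (omega i * omega j * Jac K i j * Wt K k i j)).
  rewrite [RHS]exchange_big /=; apply: eq_bigr => i _; rewrite [RHS]exchange_big /=.
  apply: eq_bigr => j _; rewrite mulr_sumr; apply: eq_bigr => k _.
  by rewrite /q; ring.
under eq_bigr => k _ do rewrite scheme_weak.
rewrite sumrB -[X in X - _]opprK -sumrN.
under eq_bigr => k _ do rewrite opprB opprK.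
have pull (c : 'I_N.+1 -> R) (X : 'I_3 -> 'I_N.+1 -> 'I_N.+1 -> R) :
    \sum_k \sum_j c j * \sum_i X k j i = \sum_j c j * \sum_i \sum_k X k j i.
  rewrite exchange_big /=; apply: eq_bigr => j _; rewrite -mulr_sumr exchange_big.
  by [].
rewrite big_split /= (pull _ (fun k i j => q k i j * line_eta K k i j)).
rewrite (pull _ (fun k j i => q k i j * line_xi K k i j)) [X in - X - _]addrC.
rewrite lines_energy -opprD; congr (- _).
rewrite [X in _ + X = _]exchange_big -big_split /=; apply: eq_bigr => s _.
rewrite [X in _ + X = _]exchange_big -big_split /=; apply: eq_bigr => m _.
rewrite -mulr_sumr -mulrDr; congr (_ * _).
rewrite /face_energy !sum_ord3 /face_term !vec3_0 !vec3_1 !vec3_2 /q /inner /=.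
rewrite mulr0 mul0r addr0.
by rewrite /entropy_vars !vec3E; ring.
Qed.

(** * Cancellation across faces and the lake at rest *)

Lemma paired_nbr (f : face) m : paired (nbr f) (paired f m) = m.
Proof. by rewrite /paired flip_nbr; case: (flip f); rewrite ?rev_ordK. Qed.

Lemma face_normal_nbr (f : face) m : face_normal (nbr f) (paired f m) = - face_normal f m.
Proof. exact: mesh_normals. Qed.

Lemma face_flux_ec_nbr k (f : face) m :
  face_flux_ec k (nbr f) (paired f m) = - face_flux_ec k f m.
Proof.
by rewrite /face_flux_ec face_normal_nbr nbr_involutive paired_nbr flux_ec_nN flux_ec_nC.
Qed.

(** Adding the two sides gives the jump condition [entropy_jump_ec]; its bottom term is balanced by
    the two halves of the interface source, which add up to a mean velocity. *)
Lemma face_energy_nbr (f : face) m : face_energy (nbr f) (paired f m) = - face_energy f m.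
Proof.
have lincomb (x y u v : R) : u = v -> x + y = u - v -> x = - y.
  by move=> -> /eqP; rewrite subrr addr_eq0 => /eqP.
apply: lincomb (entropy_jump_ec g (face_normal f m) (st f m)
  (st (nbr f) (paired f m)) (bt f m) (bt (nbr f) (paired f m))) _.
rewrite /face_energy !sum_ord3 !face_flux_ec_nbr face_normal_nbr nbr_involutive paired_nbr.
rewrite /face_flux_ec /potential_n /avg /=.
by field.
Qed.

(** Reindexing by the pairing of faces and of their nodes shows that the sum equals its own
    negative. *)
Lemma face_sum_cancel (Phi : face -> 'I_N.+1 -> R) :
  (forall f m, Phi (nbr f) (paired f m) = - Phi f m) ->
  \sum_K \sum_s \sum_m omega m * Phi (K, s) m = 0.
Proof.
move=> Phi_nbr.
rewrite (pair_bigA _ (fun K s => \sum_m omega m * Phi (K, s) m)) /=.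
set S := \sum_f _.
suff : S = - S by move=> SN; lra.
rewrite {1}/S (reindex_inj (inv_inj (@nbr_involutive _ _ _ T))) -sumrN.
apply: eq_bigr => f _; rewrite (reindex_inj (h := paired f)) /=.
  rewrite -sumrN; apply: eq_bigr => m _.
  rewrite -!surjective_pairing Phi_nbr mulrN; congr (- (_ * _)).
  by rewrite /paired; case: (flip f); rewrite ?lgl_weight_rev.
by move=> m m'; rewrite /paired; case: (flip f) => // /rev_ord_inj.
Qed.

Lemma face_sum_flux_ec k : \sum_K \sum_s \sum_m omega m * face_flux_ec k (K, s) m = 0.
Proof. by apply: face_sum_cancel => f m; exact: face_flux_ec_nbr. Qed.

Lemma face_sum_energy : \sum_K \sum_s \sum_m omega m * face_energy (K, s) m = 0.
Proof. by apply: face_sum_cancel => f m; exact: face_energy_nbr. Qed.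

(** All face terms vanish, the line terms of both directions cancel by the metric identities, and
    the weights and the Jacobian are nonzero. *)
Lemma lake_at_rest_steady : lake_at_rest b W -> forall K k, Wt K k = 0.
Proof.
move=> [c rest] K k; apply/matrixP => i j; rewrite mxE.
have face0 f m : face_term k f m = 0.
  have [hb u0 v0] := rest f.1 (side_node f.2 m).1 (side_node f.2 m).2.
  have [hb' u0' v0'] := rest (nbr f).1 (side_node (nbr f).2 (paired f m)).1
    (side_node (nbr f).2 (paired f m)).2.
  rewrite /face_term /face_flux_ec; apply: face_rest => //; try exact: W_gt0.
  exact: etrans hb (esym hb').
have xi0 : line_xi K k i j = g / 2 * c * height (state W K i j) *
    vec3 0 (\sum_m Q i m * (normal_xi K m j).1) (\sum_m Q i m * (normal_xi K m j).2) 0 k.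
  apply: line_rest => [|i'|i'|i'|i']; first exact: sbp_coef_row_sum.
  - exact: W_gt0.
  - by have [] := rest K i' j.
  - by have [] := rest K i' j.
  - by have [] := rest K i' j.
have eta0 : line_eta K k i j = g / 2 * c * height (state W K i j) *
    vec3 0 (\sum_m Q j m * (normal_eta K i m).1) (\sum_m Q j m * (normal_eta K i m).2) 0 k.
  apply: line_rest => [|j'|j'|j'|j']; first exact: sbp_coef_row_sum.
  - exact: W_gt0.
  - by have [] := rest K i j'.
  - by have [] := rest K i j'.
  - by have [] := rest K i j'.
have /eqP : omega i * omega j * Jac K i j * Wt K k i j = 0.
  rewrite scheme_entry !face0 !mulr0 !addr0 xi0 eta0.
  transitivity (- (g / 2 * c * height (state W K i j)) *
   vec3 0 (omega j * \sum_m Q i m * (normal_xi K m j).1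
  + omega i * \sum_m Q j m * (normal_eta K i m).1)
  (omega j * \sum_m Q i m * (normal_xi K m j).2
  + omega i * \sum_m Q j m * (normal_eta K i m).2) 0 k).
    by case: k {face0 xi0 eta0} => -[|[|[|//]]] lek; rewrite !mxE /=; ring.
  rewrite metric_identity1 metric_identity2.
  by case: k {face0 xi0 eta0} => -[|[|[|//]]] lek; rewrite !mxE /= mulr0.
rewrite !mulf_eq0 !(negPf (lgl_weight_neq0 N_gt0 xi_lgl _)) /=.
by rewrite (negPf (lt0r_neq0 (mesh_jacobian K i j))) => /eqP.
Qed.

End Elements.

(** * The entropy pair *)

Section Derivatives.
Variables (R : realType) (x : R).
Implicit Types f h : R -> R.

Lemma is_deriveD_fun f h df dh : is_derive x 1 f df -> is_derive x 1 h dh ->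
  is_derive x 1 (fun s => f s + h s) (df + dh).
Proof. exact: is_deriveD. Qed.

Lemma is_deriveM_fun f h df dh : is_derive x 1 f df -> is_derive x 1 h dh ->
  is_derive x 1 (fun s => f s * h s) (f x * dh + df * h x).
Proof. by move=> df' dh'; rewrite (mulrC df); exact: is_deriveM. Qed.

Lemma is_derive_cst_fun (c : R) : is_derive x 1 (fun _ : R => c) 0.
Proof. exact: is_derive_cst. Qed.

Lemma is_deriveZ_fun f df (c : R) : is_derive x 1 f df ->
  is_derive x 1 (fun s => c * f s) (c * df).
Proof.
move=> df'; apply: is_derive_eq (is_deriveM_fun (is_derive_cst_fun c) df') _.
by rewrite mul0r addr0.
Qed.

Lemma is_deriveV_fun f df : f x != 0 -> is_derive x 1 f df ->
  is_derive x 1 (fun s => (f s)^-1) (- df / f x ^+ 2).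
Proof.
move=> fx0 [Df dfE]; apply: DeriveDef; first exact: derivableV.
by rewrite deriveV // dfE /GRing.scale /= mulrC !mulrN mulNr.
Qed.

Lemma is_derive_bigsum (I : Type) (r : seq I) (F : I -> R -> R) (dF : I -> R) :
  (forall i, is_derive x 1 (F i) (dF i)) ->
  is_derive x 1 (fun s => \sum_(i <- r) F i s) (\sum_(i <- r) dF i).
Proof.
move=> dFi; elim: r => [|i r IH].
  rewrite big_nil (_ : (fun s => _) = fun=> 0); first exact: is_derive_cst_fun.
  by apply/funext => s; rewrite big_nil.
rewrite big_cons (_ : (fun s => _) = fun s => F i s + \sum_(i <- r) F i s).
  exact: is_deriveD_fun.
by apply/funext => s; rewrite big_cons.
Qed.

Lemma is_derive_derive1 f : derivable f x 1 -> is_derive x 1 f (derive1 f x).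
Proof. by rewrite derive1E; exact: derivableP. Qed.

Lemma derive1_val f df : is_derive x 1 f df -> derive1 f x = df.
Proof. by move=> [_ <-]; rewrite derive1E. Qed.

Section Curve.
Variables (g : R) (w : R -> 'rV[R]_3) (d : 'rV[R]_3).
Hypothesis w_gt0 : 0 < height (w x).
Hypothesis dw : forall k, is_derive x 1 (fun s => w s 0 k) (d 0 k).

Local Notation u := (velx (w x)).
Local Notation v := (vely (w x)).
Local Notation h := (height (w x)).

Lemma is_derive_velx : is_derive x 1 (fun s => velx (w s)) ((d 0 1 - u * d 0 0) / h).
Proof.
have h0 := lt0r_neq0 w_gt0.
apply: is_derive_eq (is_deriveM_fun (dw 1) (is_deriveV_fun h0 (dw 0))) _.
by rewrite -/(momx (w x)) -/(height (w x)) momxE //; field.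
Qed.

Lemma is_derive_vely : is_derive x 1 (fun s => vely (w s)) ((d 0 2 - v * d 0 0) / h).
Proof.
have h0 := lt0r_neq0 w_gt0.
apply: is_derive_eq (is_deriveM_fun (dw 2) (is_deriveV_fun h0 (dw 0))) _.
by rewrite -/(momy (w x)) -/(height (w x)) momyE //; field.
Qed.

Lemma is_derive_sqr f df : is_derive x 1 f df ->
  is_derive x 1 (fun s => f s ^+ 2) (2 * f x * df).
Proof.
move=> df'; apply: is_derive_eq (is_deriveM_fun df' df') _.
by ring.
Qed.

Lemma is_derive_half f df : is_derive x 1 f df -> is_derive x 1 (fun s => f s / 2) (df / 2).
Proof.
move=> df'; apply: is_derive_eq (is_deriveM_fun df' (is_derive_cst_fun 2^-1)) _.
by rewrite mulr0 add0r.
Qed.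

Let dh : is_derive x 1 (fun s => height (w s)) (d 0 0) := dw 0.
Let dm : is_derive x 1 (fun s => momx (w s)) (d 0 1) := dw 1.
Let dn : is_derive x 1 (fun s => momy (w s)) (d 0 2) := dw 2.
Let du := is_derive_velx.
Let dv := is_derive_vely.

(** The value is the Jacobian matrix of the flux applied to [d]. *)
Lemma is_derive_flux_f k : is_derive x 1 (fun s => flux_f g (w s) 0 k)
  (vec3 (d 0 1) (2 * u * d 0 1 - u ^+ 2 * d 0 0 + g * h * d 0 0)
        (v * d 0 1 + u * d 0 2 - u * v * d 0 0) 0 k).
Proof.
have h0 := lt0r_neq0 w_gt0.
case: k => -[|[|[|//]]] lek; rewrite mxE /=.
- by rewrite (_ : (fun s => _) = fun s => momx (w s)) //; apply/funext => s; rewrite mxE.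
- rewrite (_ : (fun s => _) = fun s => height (w s) * velx (w s) ^+ 2 + g * height (w s) ^+ 2 / 2);
    last by apply/funext => s; rewrite mxE.
  apply: is_derive_eq (is_deriveD_fun (is_deriveM_fun dh (is_derive_sqr du))
    (is_derive_half (is_deriveZ_fun g (is_derive_sqr dh)))) _.
  by field.
- rewrite (_ : (fun s => _) = fun s => height (w s) * velx (w s) * vely (w s));
    last by apply/funext => s; rewrite mxE.
  apply: is_derive_eq (is_deriveM_fun (is_deriveM_fun dh du) dv) _.
  by field.
Qed.

Lemma is_derive_flux_g k : is_derive x 1 (fun s => flux_g g (w s) 0 k)
  (vec3 (d 0 2) (v * d 0 1 + u * d 0 2 - u * v * d 0 0)
        (2 * v * d 0 2 - v ^+ 2 * d 0 0 + g * h * d 0 0) 0 k).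
Proof.
have h0 := lt0r_neq0 w_gt0.
case: k => -[|[|[|//]]] lek; rewrite mxE /=.
- by rewrite (_ : (fun s => _) = fun s => momy (w s)) //; apply/funext => s; rewrite mxE.
- rewrite (_ : (fun s => _) = fun s => height (w s) * velx (w s) * vely (w s));
    last by apply/funext => s; rewrite mxE.
  apply: is_derive_eq (is_deriveM_fun (is_deriveM_fun dh du) dv) _.
  by field.
- rewrite (_ : (fun s => _) = fun s => height (w s) * vely (w s) ^+ 2 + g * height (w s) ^+ 2 / 2);
    last by apply/funext => s; rewrite mxE.
  apply: is_derive_eq (is_deriveD_fun (is_deriveM_fun dh (is_derive_sqr dv))
    (is_derive_half (is_deriveZ_fun g (is_derive_sqr dh)))) _.
  by field.
Qed.

Lemma is_derive_energy (b : R) : is_derive x 1 (fun s => energy g (w s) b)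
  (\sum_k entropy_vars g (w x) b 0 k * d 0 k).
Proof.
have h0 := lt0r_neq0 w_gt0.
apply: is_derive_eq (is_deriveD_fun (is_deriveD_fun
  (is_derive_half (is_deriveM_fun dh (is_deriveD_fun (is_derive_sqr du) (is_derive_sqr dv))))
  (is_derive_half (is_deriveZ_fun g (is_derive_sqr dh))))
  (is_deriveM_fun (is_deriveZ_fun g dh) (is_derive_cst_fun b))) _.
by rewrite sum_ord3 !vec3E; field.
Qed.

(** Bernoulli's total head times [g]; its product with the momentum is the energy flux. *)
Definition energy_head (w : 'rV[R]_3) (b : R) : R :=
  (velx w ^+ 2 + vely w ^+ 2) / 2 + g * (height w + b).

Variables (b : R -> R) (db : R).
Hypothesis dbx : is_derive x 1 b db.

Lemma is_derive_energy_head : is_derive x 1 (fun s => energy_head (w s) (b s))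
  ((u * (d 0 1 - u * d 0 0) + v * (d 0 2 - v * d 0 0)) / h + g * (d 0 0 + db)).
Proof.
have h0 := lt0r_neq0 w_gt0.
apply: is_derive_eq (is_deriveD_fun
  (is_derive_half (is_deriveD_fun (is_derive_sqr du) (is_derive_sqr dv)))
  (is_deriveZ_fun g (is_deriveD_fun dh dbx))) _.
by field.
Qed.

Lemma is_derive_energy_flux_x : is_derive x 1 (fun s => momx (w s) * energy_head (w s) (b s))
  (d 0 1 * energy_head (w x) (b x)
   + u * (u * (d 0 1 - u * d 0 0) + v * (d 0 2 - v * d 0 0)) + h * u * g * (d 0 0 + db)).
Proof.
have h0 := lt0r_neq0 w_gt0.
apply: is_derive_eq (is_deriveM_fun dm is_derive_energy_head) _.
by rewrite momxE //; field.
Qed.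

Lemma is_derive_energy_flux_y : is_derive x 1 (fun s => momy (w s) * energy_head (w s) (b s))
  (d 0 2 * energy_head (w x) (b x)
   + v * (u * (d 0 1 - u * d 0 0) + v * (d 0 2 - v * d 0 0)) + h * v * g * (d 0 0 + db)).
Proof.
have h0 := lt0r_neq0 w_gt0.
apply: is_derive_eq (is_deriveM_fun dn is_derive_energy_head) _.
by rewrite momyE //; field.
Qed.

End Curve.
End Derivatives.

(** * Strict convexity and the energy equation *)

Section EntropyFunction.
Variables (R : realType) (g : R).
Hypothesis g_gt0 : 0 < g.

Lemma energy_strictly_convex (b : R) (w w' : 'rV[R]_3) (s : R) :
  0 < height w -> 0 < height w' -> w <> w' -> 0 < s < 1 ->
  energy g (s *: w + (1 - s) *: w') b < s * energy g w b + (1 - s) * energy g w' b.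
Proof.
move=> h0 h0' neq /andP[s0 s1].
set z := s *: w + _.
have zE k : z 0 k = s * w 0 k + (1 - s) * w' 0 k by rewrite !mxE.
have hz : height z = s * height w + (1 - s) * height w' by exact: zE.
have s1' : 0 < 1 - s by rewrite subr_gt0.
have hz0 : 0 < height z by rewrite hz addr_gt0 ?mulr_gt0.
have uz : velx z = (s * (height w * velx w) + (1 - s) * (height w' * velx w')) / height z.
  by rewrite -!momxE // /velx /momx zE.
have vz : vely z = (s * (height w * vely w) + (1 - s) * (height w' * vely w')) / height z.
  by rewrite -!momyE // /vely /momy zE.
rewrite -subr_gt0.
(* The convexity gap in closed form; the bottom contributes linearly in the height and drops out. *)
have -> : s * energy g w b + (1 - s) * energy g w' b - energy g z b =
    s * (1 - s) / 2 * (height w * height w' / height z *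
      ((velx w - velx w') ^+ 2 + (vely w - vely w') ^+ 2) + g * (height w - height w') ^+ 2).
  rewrite /energy uz vz; move: (lt0r_neq0 hz0); rewrite hz => hz1.
  by field.
rewrite mulr_gt0 ?divr_gt0 ?mulr_gt0 //.
have c0 : 0 < height w * height w' / height z by rewrite divr_gt0 ?mulr_gt0.
(* If the heights differ, the gravity part is positive. If they agree, distinct states must have
   distinct velocities. *)
have [eqh|neqh] := eqVneq (height w) (height w'); last first.
  apply: ltr_wpDl; first by rewrite mulr_ge0 ?addr_ge0 ?sqr_ge0 ?(ltW c0).
  by rewrite mulr_gt0 // exprn_even_gt0 //= subr_eq0.
apply: ltr_pwDl; last by rewrite mulr_ge0 ?sqr_ge0 ?(ltW g_gt0).
rewrite mulr_gt0 //.
rewrite lt_neqAle addr_ge0 ?sqr_ge0 // andbT eq_sym paddr_eq0 ?sqr_ge0 //.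
rewrite !sqrf_eq0 !subr_eq0; apply/negP => /andP[/eqP equ /eqP eqv].
apply: neq; apply/rowP => -[[|[|[|//]]] lek].
- by move: eqh; rewrite /height; have -> : Ordinal lek = 0 by exact: val_inj.
- have -> : Ordinal lek = 1 by exact: val_inj.
  by rewrite -/(momx w) -/(momx w') !momxE // eqh equ.
- have -> : Ordinal lek = 2 by exact: val_inj.
  by rewrite -/(momy w) -/(momy w') !momyE // eqh eqv.
Qed.

Lemma energy_entropy_function : entropy_function g (energy g).
Proof.
split; first exact: energy_strictly_convex.
exists (fun w b => momx w * energy_head g w b), (fun w b => momy w * energy_head g w b).
move=> D w b _ sol t x y Dtxy.
have [w0 dw dbx dby eqs] := sol t x y Dtxy.
pose dt : 'rV[R]_3 := \row_k derive1 (fun s => w s x y 0 k) t.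
pose dx : 'rV[R]_3 := \row_k derive1 (fun s => w t s y 0 k) x.
pose dy : 'rV[R]_3 := \row_k derive1 (fun s => w t x s 0 k) y.
have Dt k : is_derive t 1 (fun s => w s x y 0 k) (dt 0 k).
  by rewrite mxE; apply: is_derive_derive1; have [] := dw k.
have Dx k : is_derive x 1 (fun s => w t s y 0 k) (dx 0 k).
  by rewrite mxE; apply: is_derive_derive1; have [] := dw k.
have Dy k : is_derive y 1 (fun s => w t x s 0 k) (dy 0 k).
  by rewrite mxE; apply: is_derive_derive1; have [] := dw k.
pose bx := derive1 (fun s => b s y) x; pose b_y := derive1 (fun s => b x s) y.
have Dbx : is_derive x 1 (fun s => b s y) bx by exact: is_derive_derive1.
have Dby : is_derive y 1 (fun s => b x s) b_y by exact: is_derive_derive1.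
do 3 eexists; split.
- exact: (is_derive_energy g w0 Dt).
- exact: (is_derive_energy_flux_x g w0 Dx Dbx).
- exact: (is_derive_energy_flux_y g w0 Dy Dby).
have e0 := eqs 0; have e1 := eqs 1; have e2 := eqs 2.
move: e0 e1 e2.
rewrite !(derive1_val (is_derive_flux_f g w0 Dx _)).
rewrite !(derive1_val (is_derive_flux_g g w0 Dy _)).
rewrite !(derive1_val (Dt _)) !vec3E -/bx -/b_y.
move=> /eqP + /eqP + /eqP; rewrite -subr_eq0 => /eqP e0.
rewrite -subr_eq0 => /eqP e1; rewrite -subr_eq0 => /eqP e2.
rewrite sum_ord3 !vec3E /energy_head.
move: e0 e1 e2; clearbody dt dx dy bx b_y; move=> e0 e1 e2.
have lincomb (p q r x0 x1 x2 z : R) : x0 = 0 -> x1 = 0 -> x2 = 0 ->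
    z = p * x0 + q * x1 + r * x2 -> z = 0.
  by move=> -> -> ->; rewrite !mulr0 !addr0.
(* The energy equation is the combination of the three balance laws with the entropy variables as
   coefficients. *)
apply: (lincomb
  (g * (height (w t x y) + b x y) - (velx (w t x y) ^+ 2 + vely (w t x y) ^+ 2) / 2)
  (velx (w t x y)) (vely (w t x y)) _ _ _ _ e0 e1 e2).
by field.
Qed.

End EntropyFunction.

(** * Conservation along solutions *)

Section Conservation.
Variables (R : realType) (N : nat) (xi : 'I_N.+1 -> R) (T : mesh xi) (g : R).
Hypotheses (N_gt0 : (0 < N)%N) (xi_lgl : lgl_nodes xi).
Variable b : elem T -> 'M[R]_N.+1.

Local Notation omega := (lgl_weight xi).

Lemma is_derive_mesh_integral (a : R -> elem T -> 'M[R]_N.+1) (da : elem T -> 'M[R]_N.+1) (t : R) :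
  (forall K i j, is_derive t 1 (fun s => a s K i j) (da K i j)) ->
  is_derive t 1 (fun s => mesh_integral (a s)) (mesh_integral da).
Proof.
move=> Da; apply: is_derive_bigsum => K; apply: is_derive_bigsum => i.
apply: is_derive_bigsum => j; exact: is_deriveZ_fun.
Qed.

Lemma is_derive_state (W : R -> nodal_field T) (t : R) K i j :
  (forall K k i j, derivable (fun s => W s K k i j) t 1) ->
  forall k, is_derive t 1 (fun s => state (W s) K i j 0 k)
    (state (time_derivative W t) K i j 0 k).
Proof.
move=> dW k; rewrite !mxE (_ : (fun s => _) = fun s => W s K k i j).
  exact: is_derive_derive1.
by apply/funext => s; rewrite mxE.
Qed.

Lemma conserves_component k : k = 0 \/ (exists c, forall K, b K = const_mx c) ->
  discretely_conserves g b k.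
Proof.
move=> kb; split.
  move=> W Wt W0 sch K; rewrite (element_conservation N_gt0 xi_lgl sch W0) //.
  rewrite -opprD; congr (- _); rewrite sum_side -!big_split /=.
  apply: eq_bigr => m _.
  have maxN0 : (ord_max : 'I_N.+1) == ord0 = false.
    by rewrite eq_sym (negPf (ord0_neq_max N_gt0)).
  rewrite !mxE eqxx maxN0 eqxx.
  rewrite /face_flux_ec /face_normal /outward_normal /flux_ec_n /= /at_side /Fstar /Gstar /=.
  by rewrite !outerE /inner /y_eta /x_eta /y_xi /x_xi /=; ring.
move=> I W _ sol t It; have [W0 dW sch] := sol t It.
(* The target value 0 is traded for the vanishing sum of face fluxes, which is element by element
   the integral of the time derivative. *)
have -> : 0 = mesh_integral (fun K => time_derivative W t K k).
  rewrite -oppr0 -(face_sum_flux_ec g N_gt0 xi_lgl (W t) k) -sumrN.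
  by apply: eq_bigr => K _; rewrite -(element_conservation N_gt0 xi_lgl sch W0).
apply: is_derive_mesh_integral => K i j; rewrite mxE.
exact: is_derive_derive1.
Qed.

Lemma conserves_energy : conserves_total_energy g b.
Proof.
move=> I W _ sol t It; have [W0 dW sch] := sol t It.
(* The nodal energy rate by the chain rule; the bottom is constant in time. *)
pose de K : 'M[R]_N.+1 := \matrix_(i, j) \sum_k
  entropy_vars g (state (W t) K i j) (b K i j) 0 k * time_derivative W t K k i j.
have -> : 0 = mesh_integral de.
  rewrite -oppr0 -(face_sum_energy g N_gt0 xi_lgl b (W t)) -sumrN.
  apply: eq_bigr => K _; rewrite -(element_energy N_gt0 xi_lgl sch W0).
  by apply: eq_bigr => i _; apply: eq_bigr => j _; rewrite [de K i j]mxE.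
apply: is_derive_mesh_integral => K i j; rewrite mxE.
rewrite (_ : (fun s => _) = fun s => energy g (state (W s) K i j) (b K i j)); last first.
  by apply/funext => s; rewrite mxE.
have dE := is_derive_energy (w := fun s => state (W s) K i j) g (W0 K i j)
  (is_derive_state K i j dW) (b K i j).
apply: is_derive_eq dE _.
by apply: eq_bigr => k _; rewrite [state (time_derivative _ _) _ _ _ _ _]mxE.
Qed.

End Conservation.

Theorem theorem1 (R : realType) (N : nat) (xi : 'I_N.+1 -> R) (T : mesh xi)
    (g : R) (b : elem T -> 'M[R]_N.+1) :
  (1 <= N)%N -> lgl_nodes xi -> 0 < g ->
  [/\ discretely_conserves g b 0,
      (exists c : R, forall K, b K = const_mx c) ->
        discretely_conserves g b 1 /\ discretely_conserves g b 2,
      entropy_function g (energy g) /\ conserves_total_energy g b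
    & discretely_well_balanced g b].
Proof.
move=> N_gt0 xi_lgl g_gt0; split.
- by apply: conserves_component => //; left.
- by move=> bc; split; apply: conserves_component => //; right.
- by split; [exact: energy_entropy_function|exact: conserves_energy].
- by move=> W Wt W0 rest sch; exact: (lake_at_rest_steady N_gt0 xi_lgl sch W0 rest).
Qed.
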